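(* Suppose $\mathcal L$ is convex-concave over $\mathcal X\times\mathcal Y$. Let $\{x_t,y_t\}_{t\ge0}$ be the sequence generated by the PO-LMO algorithm (described in the context) with $\tau_t=\Theta(t^{-a})$, $\beta_t=\Theta(t^{-b})$ (or $\beta_t=0$ where indicated) and $\sigma=\tau_0$. The following hold for any $T\ge1$, with constants hidden in $O(\cdot)$, $\widetilde O(\cdot)$ independent of $T$. (i) (Convex-concave.) If the standing assumption holds and $a=\frac23$, $b=\frac13$, then $$\frac1{T+1}\sum_{t=0}^TG^{\mathrm{Opt}}_{\mathcal X}(x_t)\le O(T^{-1/3}),\qquad \frac1{T+1}\sum_{t=0}^TG_{\mathcal Y}(x_t,y_t)\le O(T^{-1/3}).$$ (ii) (Convex-strongly concave.) If the standing assumption holds with $\mu>0$, and $a=\frac12$, $\beta_t=0$ for all $t$, then $$\frac1{T+1}\sum_{t=0}^TG^{\mathrm{Opt}}_{\mathcal X}(x_t)\le\widetilde O(T^{-1/2}),\qquad \frac1{T+1}\sum_{t=0}^TG_{\mathcal Y}(x_t,y_t)\le\widetilde O(T^{-1/2}).$$ (iii) (Convex-strongly concave, strongly convex $\mathcal Y$.) If the standing assumption holds with $\mu>0$, $\mathcal Y$ is an $\alpha$-strongly convex set for some $\alpha>0$, and $a=\frac13$, $\beta_t=0$ for all $t$, then $$\frac1{T+1}\sum_{t=0}^TG^{\mathrm{Opt}}_{\mathcal X}(x_t)\le\widetilde O(T^{-2/3}),\qquad \frac1{T+1}\sum_{t=0}^TG_{\mathcal Y}(x_t,y_t)\le\widetilde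 O(T^{-2/3}).$$
   Context: Notation: $\|\cdot\|$ is the Euclidean norm; $\widetilde O$ suppresses logarithmic factors. Since the index starts at $t=0$, $\tau_t=\Theta(t^{-a})$ is read as $c_1(t+1)^{-a}\le\tau_t\le c_2(t+1)^{-a}$ for all $t\ge 0$ and some constants $0<c_1\le c_2$, and similarly for $\beta_t=\Theta(t^{-b})$. Standing assumption. $\mathcal X\subset\mathbb R^{d_x}$ and $\mathcal Y\subset\mathbb R^{d_y}$ are nonempty compact convex sets with diameters $D_{\mathcal X}$, $D_{\mathcal Y}$. The payoff $\mathcal L:\mathbb R^{d_x}\times\mathbb R^{d_y}\to\mathbb R$ is continuously differentiable on an open set containing $\mathcal X\times\mathcal Y$; for some $\mu\ge 0$ and every $x\in\mathcal X$, $\mathcal L(x,\cdot)$ is $\mu$-strongly concave on $\mathcal Y$ ($\mu=0$ meaning concave); and there are $L_{xx},L_{yy}\ge 0$, $L_{yx}>0$ such that for all $(x,y),(x',y')\in\mathcal X\times\mathcal Y$, $\|\nabla_x\mathcal L(x,y)-\nabla_x\mathcal L(x',y')\|\le L_{xx}\|x-x'\|+L_{yx}\|y-y'\|$ and $\|\nabla_y\mathcal L(x,y)-\nabla_y\mathcal L(x',y')\|\le L_{yx}\|x-x'\|+L_{yy}\|y-y'\|$. Strongly convex set: $\mathcal Y$ is $\alpha$-strongly convex if for all $y,y'\in\mathcal Y$, $z\in\mathbb R^{d_y}$ with $\|z\|=1$, $\xi\in[0,1]$: $\xi y+(1-\xi)y'+\xi(1-\xi)\frac{\alpha}{2}\|y-y'\|^2z\in\mathcal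 Y$. Oracles: $\mathrm{LMO}_{\mathcal U}(d)$ denotes an arbitrary element of $\arg\min_{v\in\mathcal U}d^\top v$; $\mathrm{PO}_{\mathcal U}(u)=\arg\min_{v\in\mathcal U}\|u-v\|^2$ is Euclidean projection. Gaps: $f(x)=\max_{y\in\mathcal Y}\mathcal L(x,y)$; $G^{\mathrm{Opt}}_{\mathcal X}(x)=f(x)-\min_{v\in\mathcal X}f(v)$; $G_{\mathcal Y}(x,y)=\max_{u\in\mathcal Y}\mathcal L(x,u)-\mathcal L(x,y)$. The parameter $\sigma>0$ is the one in the projection-based gap $\left\|\frac1\sigma\left(\mathrm{PO}_{\mathcal X}(x-\sigma\nabla_x\mathcal L(x,y))-x\right)\right\|$; this gap does not appear in the conclusions here. Regularized payoff: $\mathcal L_\beta(x,y)=\mathcal L(x,y)-\frac{\beta}{2}\|y-y_0\|^2$, where $y_0\in\mathcal Y$ is the initial dual iterate. PO-LMO algorithm: start from $x_0\in\mathcal X$, $y_0\in\mathcal Y$; for $t=0,1,2,\dots$: $x_{t+1}=\mathrm{PO}_{\mathcal X}(x_t-\tau_t\nabla_x\mathcal L(x_t,y_t))$; $u_t=\mathrm{LMO}_{\mathcal Y}(-\nabla_y\mathcal L_{\beta_t}(x_t,y_t))$, $\gamma_t=\min\left\{\frac{\nabla_y\mathcal L_{\beta_t}(x_t,y_t)^\top(u_t-y_t)}{(L_{yy}+\beta_t)\|u_t-y_t\|^2},1\right\}$, $y_{t+1}=y_t+\gamma_t(u_t-y_t)$ (if $u_t=y_t$, then $y_{t+1}=y_t$).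 *)

(* Defs.v *)
From HB Require Import structures.
From mathcomp Require Import all_boot all_order all_algebra.
From mathcomp Require Import all_classical all_reals all_analysis.

Set Implicit Arguments.
Unset Strict Implicit.
Unset Printing Implicit Defensive.

Import Order.TTheory GRing.Theory Num.Theory.
Import numFieldNormedType.Exports.

Local Open Scope classical_set_scope.
Local Open Scope ring_scope.

Definition dot (R : realType) (n : nat) (u v : 'rV[R]_n) : R :=
  (u *m v^T) 0 0.

(* The library norm `|u| on row vectors is the sup norm; distances below are
   Euclidean. Both norms induce the same topology and differentiability. *)
Definition enorm (R : realType) (n : nat) (u : 'rV[R]_n) : R :=
  Num.sqrt (dot u u).

Definition grad (R : realType) (n : nat) (f : 'rV[R]_n -> R) (x : 'rV[R]_n) :
    'rV[R]_n :=
  \row_i 'D_(delta_mx 0 i) f x.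

Definition argmin (R : realType) (T : Type) (S : set T) (g : T -> R) : set T :=
  [set v | S v /\ forall w, S w -> g v <= g w].

Definition LMO (R : realType) (n : nat) (S : set 'rV[R]_n) (d : 'rV[R]_n) :=
  argmin S (fun v => dot d v).

Definition PO (R : realType) (n : nat) (S : set 'rV[R]_n) (u : 'rV[R]_n) :=
  argmin S (fun v => enorm (u - v) ^+ 2).

(* On finite-dimensional spaces, continuity of p |-> 'd f p is continuity of
   each p |-> 'D_v f p. *)
Definition C1_on (R : realType) (V : normedModType R) (U : set V) (f : V -> R) :
    Prop :=
  forall p, U p ->
    differentiable f p /\ forall v : V, {for p, continuous ('D_v f)}.

Definition strongly_concave_on (R : realType) (n : nat) (mu : R)
    (S : set 'rV[R]_n) (g : 'rV[R]_n -> R) : Prop :=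
  forall (y y' : 'rV[R]_n) (xi : R), S y -> S y' -> 0 <= xi <= 1 ->
    xi * g y + (1 - xi) * g y'
      + mu / 2 * xi * (1 - xi) * enorm (y - y') ^+ 2
    <= g (xi *: y + (1 - xi) *: y').

Definition strongly_convex_set (R : realType) (n : nat) (alpha : R)
    (S : set 'rV[R]_n) : Prop :=
  forall (y y' z : 'rV[R]_n) (xi : R),
    S y -> S y' -> enorm z = 1 -> 0 <= xi <= 1 ->
    S (xi *: y + (1 - xi) *: y'
         + (xi * (1 - xi) * (alpha / 2) * enorm (y - y') ^+ 2) *: z).

Section Game.

Variables (R : realType) (dx dy : nat).
Variables (X : set 'rV[R]_dx) (Y : set 'rV[R]_dy).
Variable L : 'rV[R]_dx -> 'rV[R]_dy -> R.

Definition grad_x (x : 'rV[R]_dx) (y : 'rV[R]_dy) : 'rV[R]_dx :=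
  grad (fun x' => L x' y) x.

Definition grad_y (x : 'rV[R]_dx) (y : 'rV[R]_dy) : 'rV[R]_dy :=
  grad (L x) y.

Definition convex_concave : Prop :=
  (forall y, Y y -> convex_function X (fun x => L x y)) /\
  (forall x, X x -> convex_function Y (fun y => - L x y)).

Record standing_assumption (mu Lxx Lyx Lyy : R) : Prop := StandingAssumption {
  sa_X_nonempty : X !=set0;
  sa_X_compact : compact X;
  sa_X_convex : convex_set X;
  sa_Y_nonempty : Y !=set0;
  sa_Y_compact : compact Y;
  sa_Y_convex : convex_set Y;
  sa_C1 : exists U : set ('rV[R]_dx * 'rV[R]_dy),
    [/\ open U, X `*` Y `<=` U & C1_on U (fun p => L p.1 p.2)];
  sa_mu_ge0 : 0 <= mu;
  sa_concave : forall x, X x -> strongly_concave_on mu Y (L x);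
  sa_Lxx_ge0 : 0 <= Lxx;
  sa_Lyy_ge0 : 0 <= Lyy;
  sa_Lyx_gt0 : 0 < Lyx;
  sa_grad_x : forall x y x' y', X x -> Y y -> X x' -> Y y' ->
    enorm (grad_x x y - grad_x x' y')
      <= Lxx * enorm (x - x') + Lyx * enorm (y - y');
  sa_grad_y : forall x y x' y', X x -> Y y -> X x' -> Y y' ->
    enorm (grad_y x y - grad_y x' y')
      <= Lyx * enorm (x - x') + Lyy * enorm (y - y')
}.

(* Suprema and infima over X and Y are attained when X and Y are compact and L
   is continuous, so they are the max and min. *)
Definition primal (x : 'rV[R]_dx) : R := sup [set L x u | u in Y].

Definition gap_opt (x : 'rV[R]_dx) : R :=
  primal x - inf [set primal v | v in X].

Definition gap_Y (x : 'rV[R]_dx) (y : 'rV[R]_dy) : R :=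
  sup [set L x u | u in Y] - L x y.

End Game.

Definition regularized (R : realType) (dx dy : nat)
    (L : 'rV[R]_dx -> 'rV[R]_dy -> R) (y0 : 'rV[R]_dy) (beta : R)
    (x : 'rV[R]_dx) (y : 'rV[R]_dy) : R :=
  L x y - beta / 2 * enorm (y - y0) ^+ 2.

(* [x], [y] is a run of the algorithm in which [u t] is the answer of the
   linear minimization oracle at step t. When u t = y t, the update gives
   y t.+1 = y t whatever the (totalized) value of the quotient. *)
Record PO_LMO (R : realType) (dx dy : nat)
    (X : set 'rV[R]_dx) (Y : set 'rV[R]_dy)
    (L : 'rV[R]_dx -> 'rV[R]_dy -> R) (Lyy : R) (tau beta : nat -> R)
    (x : nat -> 'rV[R]_dx) (y u : nat -> 'rV[R]_dy) : Prop := MkPO_LMO {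
  pl_x0 : X (x 0%N);
  pl_y0 : Y (y 0%N);
  pl_x : forall t,
    PO X (x t - tau t *: grad_x L (x t) (y t)) (x t.+1);
  pl_u : forall t,
    LMO Y (- grad_y (regularized L (y 0%N) (beta t)) (x t) (y t)) (u t);
  pl_y : forall t,
    let g := grad_y (regularized L (y 0%N) (beta t)) (x t) (y t) in
    let gamma :=
      Num.min (dot g (u t - y t)
                 / ((Lyy + beta t) * enorm (u t - y t) ^+ 2)) 1 in
    y t.+1 = y t + gamma *: (u t - y t)
}.

(* s_t = Theta(t^(-a)), shifted by one because the index starts at t = 0. *)
Definition Theta_pow (R : realType) (a : R) (s : nat -> R) : Prop :=
  exists c1 c2 : R, [/\ 0 < c1, c1 <= c2 &
    forall t : nat,
      c1 * t.+1%:R `^ (- a) <= s t /\ s t <= c2 * t.+1%:R `^ (- a)].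

Definition average (R : realType) (g : nat -> R) (T : nat) : R :=
  T.+1%:R^-1 * \sum_(0 <= t < T.+1) g t.

Definition O_pow (R : realType) (r : R) (g : nat -> R) : Prop :=
  exists C : R, forall T : nat, (1 <= T)%N -> g T <= C * T%:R `^ (- r).

(* The factor 1 + ln T, rather than ln T, keeps the bound meaningful at
   T = 1. *)
Definition softO_pow (R : realType) (r : R) (g : nat -> R) : Prop :=
  exists (C : R) (k : nat), forall T : nat, (1 <= T)%N ->
    g T <= C * (1 + ln T%:R) ^+ k * T%:R `^ (- r).

(* Main.v *)
Require Import Defs.
From mathcomp Require Import all_boot all_order all_algebra.
From mathcomp Require Import all_classical all_reals all_analysis.
From mathcomp Require Import ring lra.

Set Implicit Arguments.
Unset Strict Implicit.
Unset Printing Implicit Defensive.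

Import Order.TTheory GRing.Theory Num.Theory.
Import numFieldNormedType.Exports.

Local Open Scope classical_set_scope.
Local Open Scope ring_scope.

(** Write [h] for the dual gap [gap_Y] along the run, [F] for the primal gap
    [gap_opt] and [d] for the length of a projected step. Everything rests on
    two coupled recursions, one per player.

    Dual player. A conditional gradient step decreases the dual gap by
    [c * r ^ n.+1] where [r ^ n = h]: this holds with [n = 1] in general
    ([fw_quadratic]) and with [n = 2] when [Y] is strongly convex ([fw_cubic]).
    Moving [x] then increases the gap by at most
    [(Lxx * d + Lyx * e) * d], where [e] is the distance from the current dual
    iterate to the best response at the new point ([gap_Y_step]).

    Primal player. The partial gradient at [(x, y)] is a subgradient of the
    primal function up to an error equal to the dual gap, so that summing the
    three-point inequality of the projection by parts bounds the sum of [F] by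
    the inverse of the last step size plus the sum of the dual gaps
    ([gap_opt_sum]). The step sizes need not be monotone: as [F] is
    nonnegative, they can be replaced by a monotone sequence of the same order.

    Merely concave payoffs. Here [d = O(tau)] and [e] is bounded, so
    [h' <= h - c * h ^ 2 + O(t ^ (- 2 / 3))] as long as [h] exceeds a multiple
    of [beta], while below this level the next gap is [O(beta)]. The gap used is
    that of the original payoff, which makes oscillations of [beta] harmless.
    Summing gives [O(T ^ (1 / 3))] for the sum of [h ^ 2], hence
    [O(T ^ (2 / 3))] for the sum of [h] ([concave_rates]).

    Strongly concave payoffs. Now [e ^ 2 = O(h + d ^ 2)]
    ([best_response_dist]), and the primal function decreases by [d ^ 2 / tau]
    up to terms of the same kind. In the potential [h + F] this decrease pays
    for all the first-order terms in [d], which leaves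
    [h' + F' <= h + F - c * r ^ n.+1 + O(tau * r ^ n) + O(tau ^ n.+1)].
    By Young's inequality the sum of [r ^ n.+1] is of the order of the sum of
    [tau ^ n.+1], that is [ln T] when [tau] is of order [t ^ (- 1 / n.+1)], and
    Hoelder's inequality turns it into the rate [n / n.+1] for [h = r ^ n]
    ([strong_rates]). *)

(** * Euclidean geometry of row vectors *)

Section Euclidean.
Variables (R : realType) (n : nat).
Implicit Types (u v w : 'rV[R]_n) (a : R).

Lemma dotE u v : dot u v = \sum_j u 0 j * v 0 j.
Proof. by rewrite /dot mxE; apply: eq_bigr => j _; rewrite mxE. Qed.

Lemma dotC u v : dot u v = dot v u.
Proof. by rewrite !dotE; apply: eq_bigr => j _; rewrite mulrC. Qed.

Lemma dotDl u v w : dot (u + v) w = dot u w + dot v w.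
Proof. by rewrite /dot mulmxDl mxE. Qed.

Lemma dotZl a u v : dot (a *: u) v = a * dot u v.
Proof. by rewrite /dot -scalemxAl mxE. Qed.

Lemma dotNl u v : dot (- u) v = - dot u v.
Proof. by rewrite /dot mulNmx mxE. Qed.

Lemma dotDr u v w : dot w (u + v) = dot w u + dot w v.
Proof. by rewrite !(dotC w) dotDl. Qed.

Lemma dotZr a u v : dot u (a *: v) = a * dot u v.
Proof. by rewrite !(dotC u) dotZl. Qed.

Lemma dotNr u v : dot u (- v) = - dot u v.
Proof. by rewrite !(dotC u) dotNl. Qed.

Definition dotL := (dotDl, dotDr, dotNl, dotNr, dotZl, dotZr).

Lemma dot_ge0 u : 0 <= dot u u.
Proof. by rewrite dotE sumr_ge0// => j _; rewrite -expr2 sqr_ge0. Qed.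

Lemma dot_eq0 u : dot u u = 0 -> u = 0.
Proof.
rewrite dotE => /psumr_eq0P u0; apply/rowP => j; rewrite mxE.
have /eqP := u0 (fun i _ => sqr_ge0 (u 0 i)) j isT.
by rewrite mulf_eq0 orbb => /eqP.
Qed.

Lemma enorm_ge0 u : 0 <= enorm u.
Proof. exact: sqrtr_ge0. Qed.

Lemma enorm_sqr u : enorm u ^+ 2 = dot u u.
Proof. by rewrite /enorm sqr_sqrtr ?dot_ge0. Qed.

Lemma enorm_eq0 u : enorm u = 0 -> u = 0.
Proof. by move=> u0; apply: dot_eq0; rewrite -enorm_sqr u0 expr0n. Qed.

Lemma enorm0 : enorm (0 : 'rV[R]_n) = 0.
Proof. by rewrite /enorm /dot mul0mx mxE sqrtr0. Qed.

Lemma enormN u : enorm (- u) = enorm u.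
Proof. by rewrite /enorm dotNl dotNr opprK. Qed.

Lemma enormBC u v : enorm (u - v) = enorm (v - u).
Proof. by rewrite -enormN opprB. Qed.

Lemma enormZ a u : 0 <= a -> enorm (a *: u) = a * enorm u.
Proof.
move=> a0; rewrite /enorm dotZl dotZr mulrA -expr2 sqrtrM ?sqr_ge0//.
by rewrite sqrtr_sqr ger0_norm.
Qed.

Lemma enorm_sqrBZ a u v :
  enorm (u - a *: v) ^+ 2 = enorm u ^+ 2 + a * (a * dot v v - 2 * dot u v).
Proof. by rewrite !enorm_sqr !dotL (dotC v u); ring. Qed.

Lemma cauchy_schwarz u v : dot u v <= enorm u * enorm v.
Proof.
have [/eqP/enorm_eq0 ->|u0] := boolP (enorm u == 0).
  by rewrite enorm0 mul0r /dot mul0mx mxE.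
have [/eqP/enorm_eq0 ->|v0] := boolP (enorm v == 0).
  by rewrite enorm0 mulr0 dotC /dot mul0mx mxE.
have up : 0 < enorm u by rewrite lt_def u0 enorm_ge0.
have vp : 0 < enorm v by rewrite lt_def v0 enorm_ge0.
have := dot_ge0 (enorm v *: u - enorm u *: v).
rewrite !dotL (dotC v u) -!enorm_sqr => H.
have {}H : 0 <= (enorm u * enorm v) * (enorm u * enorm v - dot u v) by nra.
by rewrite -subr_ge0 -(pmulr_rge0 _ (mulr_gt0 up vp)).
Qed.

Lemma cauchy_schwarzN u v : - dot u v <= enorm u * enorm v.
Proof. by rewrite -dotNl -(enormN u) cauchy_schwarz. Qed.

Lemma enormD u v : enorm (u + v) <= enorm u + enorm v.
Proof.
have uv := cauchy_schwarz u v.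
rewrite -ler_sqr ?nnegrE ?addr_ge0 ?enorm_ge0// enorm_sqr !dotL (dotC v u).
by rewrite sqrrD -!enorm_sqr; lra.
Qed.

Lemma enorm_sqr_continuous u : continuous (fun v => enorm (v - u) ^+ 2).
Proof.
have cj j : continuous (fun v : 'rV[R]_n => (v - u) 0 j).
  have -> : (fun v : 'rV[R]_n => (v - u) 0 j) = (fun v => v 0 j - u 0 j).
    by apply/funext => v; rewrite !mxE.
  move=> v; exact: (cvgB (@coord_continuous R 1 n 0 j v) (cvg_cst _)).
have -> : (fun v => enorm (v - u) ^+ 2) =
    (fun v => \sum_j (v - u) 0 j * (v - u) 0 j).
  by apply/funext => v; rewrite enorm_sqr dotE.
apply: continuous_big => [|j _ v]; first exact: add_continuous.
exact: (cvgM (cj j v) (cj j v)).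
Qed.

Lemma compact_ediam (S : set 'rV[R]_n) : compact S ->
  exists2 D, 0 < D & forall u v, S u -> S v -> enorm (u - v) <= D.
Proof.
move=> cS; have [[s Ss]|S0] := pselect (S !=set0); last first.
  by exists 1 => // u v Su; exfalso; apply: S0; exists u.
have [||c _ cmax] := @EVT_max_rV R n (fun v => enorm (v - s) ^+ 2) S _ cS.
- by exists s.
- by apply: continuous_subspaceT; exact: enorm_sqr_continuous.
have sc u : S u -> enorm (u - s) <= enorm (c - s).
  move=> Su; rewrite -ler_sqr ?nnegrE ?enorm_ge0//; exact/cmax/mem_set.
exists (enorm (c - s) + enorm (c - s) + 1).
  by have := enorm_ge0 (c - s); lra.
move=> u v Su Sv; have -> : u - v = (u - s) + (s - v) by rewrite addrA subrK.
apply: le_trans (enormD _ _) _; rewrite (enormBC s v).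
by have := sc _ Su; have := sc _ Sv; lra.
Qed.

End Euclidean.

(** * Gradients and first-order inequalities *)

Section Gradients.
Variables (R : realType) (n : nat).
Implicit Types (S : set 'rV[R]_n) (f : 'rV[R]_n -> R) (a b v : 'rV[R]_n).

Lemma convex_set_comb S a b (t : R) : convex_set S -> S a -> S b ->
  0 <= t <= 1 -> S (t *: a + (1 - t) *: b).
Proof.
move=> cS Sa Sb /andP[t0 t1].
exact/set_mem/(cS a b (Itv01 t0 t1) (mem_set Sa) (mem_set Sb)).
Qed.

Lemma convex_set_segment S a b (t : R) : convex_set S -> S a -> S b ->
  0 <= t <= 1 -> S (a + t *: (b - a)).
Proof.
move=> cS Sa Sb t01; have := convex_set_comb cS Sb Sa t01.
by rewrite scalerBl scale1r scalerBr addrCA.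
Qed.

Lemma convex_function_comb S f a b (t : R) : convex_function S f ->
  S a -> S b -> 0 <= t <= 1 ->
  f (t *: a + (1 - t) *: b) <= t * f a + (1 - t) * f b.
Proof.
move=> cf Sa Sb /andP[t0 t1].
exact: (cf (Itv01 t0 t1) a b (mem_set Sa) (mem_set Sb)).
Qed.

Lemma derive_grad f a v : differentiable f a -> 'D_v f a = dot (grad f a) v.
Proof.
move=> df; rewrite deriveE// [in LHS](row_sum_delta v) linear_sum dotE.
by apply: eq_bigr => j _; rewrite linearZ/= mxE deriveE// mulrC.
Qed.

Lemma convex_grad_le S f a b : convex_function S f -> differentiable f a ->
  S a -> S b -> dot (grad f a) (b - a) <= f b - f a.
Proof.
move=> cf df Sa Sb; rewrite -derive_grad//.
have /cvg_dnbhs_at_right cD : h^-1 *: ((f \o shift a) (h *: (b - a)) - f a)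
    @[h --> (0:R)^'] --> 'D_(b - a) f a by exact: diff_derivable.
apply: (cvgr_to_le cD); near=> h.
have h0 : 0 < h by near: h; exact: nbhs_right_gt.
have h1 : h <= 1 by near: h; exact: nbhs_right_ltW.
rewrite /GRing.scale/= mulrC ler_pdivrMr//.
have h01 : 0 <= h <= 1 by rewrite ltW.
have := convex_function_comb cf Sb Sa h01.
have -> : h *: b + (1 - h) *: a = h *: (b - a) + a.
  by rewrite scalerBl scale1r scalerBr addrA addrAC.
lra.
Unshelve. all: by end_near. Qed.

Lemma is_derive_sqnorm (c : R) a b v :
  is_derive a v (fun w => c * enorm (w - b) ^+ 2) (2 * c * dot (a - b) v).
Proof.
have lim : h^-1 *: (((fun w => c * enorm (w - b) ^+ 2) \o shift a) (h *: v)
      - c * enorm (a - b) ^+ 2) @[h --> (0:R)^'] --> 2 * c * dot (a - b) v.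
  have -> : 2 * c * dot (a - b) v = 2 * c * dot (a - b) v + 0 * (c * dot v v).
    by rewrite mul0r addr0.
  apply: (@cvg_trans _ ((fun h : R => 2 * c * dot (a - b) v + h * (c * dot v v))
     @ 0^')).
    apply: near_eq_cvg; near=> h.
    have h0 : h != 0 by near: h; exact: nbhs_dnbhs_neq.
    rewrite /= (_ : c * enorm (h *: v + a - b) ^+ 2 - c * enorm (a - b) ^+ 2
        = h * (2 * c * dot (a - b) v + h * (c * dot v v))); last first.
      by rewrite !enorm_sqr !dotL (dotC v b) (dotC v a) (dotC b a); ring.
    by rewrite /GRing.scale/= mulKf.
  apply: cvg_within_filter; apply: cvgD; first exact: cvg_cst.
  by apply: cvgM; [exact: cvg_id|exact: cvg_cst].
by apply: DeriveDef; [apply/cvg_ex; eexists; exact: lim|exact: cvg_lim lim].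
Unshelve. all: by end_near. Qed.

End Gradients.

(** * Rates, sums and averages *)

Section Rates.
Variable R : realType.
Implicit Types (s g h r e A W : nat -> R) (c C : R).

(** All powers of [t.+1] below are integer powers of one such root, so that the
    estimates are polynomial inequalities. *)
Definition nroot (m t : nat) : R := t.+1%:R `^ (m%:R^-1).

Lemma nroot_gt0 m t : 0 < nroot m t.
Proof. by rewrite powR_gt0. Qed.

Lemma nroot_exp m t : nroot m.+1 t ^+ m.+1 = t.+1%:R.
Proof.
rewrite -powR_mulrn ?powR_ge0// -powRrM mulVf ?pnatr_eq0// powRr1//.
Qed.

Lemma nroot_le m t t' : (t <= t')%N -> nroot m t <= nroot m t'.
Proof. by move=> tt'; rewrite ge0_ler_powR ?nnegrE ?invr_ge0// ler_nat. Qed.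

Lemma nroot_ge1 m t : 1 <= nroot m t.
Proof.
have := @nroot_le m 0 t (leq0n t); rewrite {1}/nroot.
by have /(congr1 (@^~ (m%:R^-1))) -> := @powR1 R.
Qed.

Lemma powR_natfrac (x : R) k m : 0 <= x ->
  x `^ (k%:R / m%:R) = (x `^ (m%:R^-1)) ^+ k.
Proof. by move=> x0; rewrite mulrC powRrM powR_mulrn ?powR_ge0. Qed.

Lemma Theta_pow_nroot k m s : Theta_pow (k%:R / m%:R) s ->
  exists c1 c2, [/\ 0 < c1, 0 < c2 & forall t,
    c1 / nroot m t ^+ k <= s t /\ s t <= c2 / nroot m t ^+ k].
Proof.
move=> [c1 [c2 [c10 c12 H]]]; exists c1, c2; split => //.
  exact: lt_le_trans c12.
by move=> t; move: (H t); rewrite powRN powR_natfrac.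
Qed.

(** The number of terms is [nroot (k + j) T ^+ (k + j)], so that dividing by it
    leaves [nroot (k + j) T ^- k]. *)
Lemma average_rate k j C g T : (0 < k + j)%N -> (0 < T)%N -> 0 <= C ->
  \sum_(0 <= t < T.+1) g t <= C * nroot (k + j) T ^+ j ->
  average g T <= C * T%:R `^ (- (k%:R / (k + j)%:R)).
Proof.
move=> kj0 T0 C0 H; rewrite /average powRN powR_natfrac//.
rewrite ler_pdivrMl//.
apply: le_trans H _; rewrite mulrCA ler_wpM2l//.
have := nroot_exp (k + j).-1 T; rewrite prednK// => <-.
rewrite exprD mulrAC.
rewrite ler_peMl ?exprn_ge0 ?(ltW (nroot_gt0 _ _))//.
rewrite ler_pdivlMr ?exprn_gt0 ?powR_gt0 ?ltr0n// mul1r.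
rewrite lerXn2r ?nnegrE ?powR_ge0//.
by rewrite ge0_ler_powR ?nnegrE ?invr_ge0// ler_nat.
Qed.

Lemma sum_inv_le_ln T : (0 < T)%N ->
  \sum_(0 <= t < T) (t.+1%:R)^-1 <= 1 + ln T%:R :> R.
Proof.
case: T => // T _; elim: T => [|T IH].
  by rewrite big_nat1 invr1 ln1 addr0.
rewrite big_nat_recr//=; apply: le_trans (lerD IH (lexx _)) _.
rewrite -addrA lerD2l -lerBrDl.
have T1 : 0 < T.+1%:R :> R by rewrite ltr0n.
have T2 : 0 < T.+2%:R :> R by rewrite ltr0n.
rewrite -lerN2 opprB -ln_div ?posrE//.
have -> : T.+1%:R / T.+2%:R = 1 + - T.+2%:R^-1 :> R.
  by move: T2; rewrite -[T.+2%:R]natr1 => T2; field; rewrite gt_eqF.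
by apply: le_ln1Dx; rewrite ltrN2 invf_lt1// ltr1n.
Qed.

(** Telescoping, because [a ^ 3 - b ^ 3 <= 3 * a ^ 2 * (a - b)] for the
    consecutive cube roots [a] and [b]. *)
Lemma sum_nroot3_sqr T :
  \sum_(0 <= t < T.+1) (nroot 3 t ^+ 2)^-1 <= 3 * nroot 3 T.
Proof.
elim: T => [|T IH].
  have := nroot_ge1 3 0; rewrite big_nat1 => r1.
  have : (nroot 3 0 ^+ 2)^-1 <= 1.
    by rewrite invf_le1 ?exprn_gt0 ?exprn_ege1// (lt_le_trans _ r1).
  by move=> /le_trans; apply; lra.
rewrite big_nat_recr//=; apply: le_trans (lerD IH (lexx _)) _.
have a0 := nroot_gt0 3 T.+1; have b0 := nroot_gt0 3 T.
have ba : nroot 3 T <= nroot 3 T.+1 by rewrite nroot_le.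
have : nroot 3 T.+1 ^+ 3 - nroot 3 T ^+ 3 = 1.
  by rewrite !nroot_exp -[T.+2%:R]natr1; ring.
move: (nroot 3 T.+1) (nroot 3 T) a0 b0 ba => a b a0 b0 ba ab1.
rewrite -lerBrDl -mulrBr -div1r ler_pdivrMr ?exprn_gt0//.
rewrite -[X in X <= _]ab1 -subr_ge0.
have -> : 3 * (a - b) * a ^+ 2 - (a ^+ 3 - b ^+ 3) =
  (a - b) ^+ 2 * (2 * a + b) by ring.
by rewrite mulr_ge0 ?sqr_ge0// addr_ge0 ?mulr_ge0 ?(ltW a0) ?(ltW b0).
Qed.

(** Summation by parts: the increments of [W] multiply [B - A], which is
    nonnegative, so that each of them can be paid by the growth of [W T * B]. *)
Lemma abel_sum_le (B c : R) g A W e :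
  (forall t, 0 <= A t <= B) -> (forall t, 0 <= W t <= W t.+1) ->
  (forall t, c * g t <= W t * (A t - A t.+1) + e t) ->
  forall T, c * \sum_(0 <= t < T.+1) g t <= W T * B + \sum_(0 <= t < T.+1) e t.
Proof.
move=> AB W_nd H T.
suff : c * \sum_(0 <= t < T.+1) g t
    <= W T * (B - A T.+1) + \sum_(0 <= t < T.+1) e t.
  move=> /le_trans; apply; rewrite lerD2r ler_wpM2l//.
    by case/andP: (W_nd T).
  by rewrite gerBl; case/andP: (AB T.+1).
elim: T => [|T IH].
  rewrite !big_nat1; apply: le_trans (H 0%N) _.
  rewrite lerD2r ler_wpM2l//; first by case/andP: (W_nd 0%N).
  by rewrite lerD2r; case/andP: (AB 0%N).
rewrite !(big_nat_recr T.+1)//= mulrDr; apply: le_trans (lerD IH (H _)) _.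
have /andP[W0 W1] := W_nd T; have /andP[A0 AB1] := AB T.+1.
have : 0 <= (W T.+1 - W T) * (B - A T.+1) by rewrite mulr_ge0// subr_ge0.
by lra.
Qed.

(** Young's inequality up to a constant, by comparing [x] with [y]. *)
Lemma young_pow (x y : R) n : 0 <= x -> 0 <= y ->
  y * x ^+ n <= x ^+ n.+1 + y ^+ n.+1.
Proof.
move=> x0 y0; have [xy|/ltW xy] := leP y x.
  by rewrite exprS -[X in X <= _]addr0 lerD ?exprn_ge0// ler_wpM2r// exprn_ge0.
rewrite [y ^+ _]exprS -[X in X <= _]add0r lerD ?exprn_ge0// ler_wpM2l//.
by rewrite lerXn2r ?nnegrE.
Qed.

(** A form of Hoelder's inequality: Young's inequality is applied to each term
    at the single scale [(nroot n.+1 T)^-1], which balances the two sums. *)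
Lemma sum_pow_le n r C T : (forall t, 0 <= r t) ->
  \sum_(0 <= t < T.+1) r t ^+ n.+1 <= C ->
  \sum_(0 <= t < T.+1) r t ^+ n <= (C + 1) * nroot n.+1 T.
Proof.
move=> r0 H; set z := nroot n.+1 T; have z0 : 0 < z by exact: nroot_gt0.
have step t : r t ^+ n <= z * r t ^+ n.+1 + z * (T.+1%:R)^-1.
  have := @young_pow (r t) z^-1 n (r0 t); rewrite invr_ge0 ltW// => /(_ isT).
  rewrite -(ler_pM2l z0) mulrA mulfV ?gt_eqF// mul1r mulrDr.
  by rewrite exprVn nroot_exp.
apply: le_trans (ler_sum _ (fun t _ => step t)) _.
rewrite big_split/= -mulr_sumr sumr_const_nat subn0 mulrDl mul1r mulrC lerD//.
  by rewrite ler_wpM2r// ltW.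
by rewrite -[leLHS]mulr_natr divfK ?pnatr_eq0.
Qed.

(** By Young's inequality half of the decrease [c * r ^ n.+1] absorbs the
    perturbation [C * s * r ^ n] at the price of a multiple of [s ^ n.+1]; the
    rest telescopes. *)
Lemma potential_sum n (c C : R) r Phi s : 0 < c -> 0 <= C ->
  (forall t, 0 <= r t) -> (forall t, 0 <= Phi t) -> (forall t, 0 <= s t) ->
  (forall t, Phi t.+1 <= Phi t - c * r t ^+ n.+1
                         + C * s t * r t ^+ n + C * s t ^+ n.+1) ->
  exists2 C', 0 <= C' & forall T,
    \sum_(0 <= t < T) r t ^+ n.+1
      <= C' * (1 + \sum_(0 <= t < T) s t ^+ n.+1).
Proof.
move=> c0 C0 r0 P0 s0 H.
have c2 : 0 < c / 2 by rewrite divr_gt0.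
pose q := 2 * C / c; have q0 : 0 <= q by rewrite !mulr_ge0// invr_ge0 ltW.
pose E := c / 2 * q ^+ n.+1 + C.
have E0 : 0 <= E by rewrite addr_ge0// mulr_ge0 ?(ltW c2)// exprn_ge0.
have step t : c / 2 * r t ^+ n.+1 <= Phi t - Phi t.+1 + E * s t ^+ n.+1.
  have := @young_pow (r t) (q * s t) n (r0 t) (mulr_ge0 q0 (s0 t)).
  rewrite exprMn -(ler_pM2l c2) mulrDr.
  have -> : c / 2 * (q * s t * r t ^+ n) = C * s t * r t ^+ n.
    by rewrite /q; field; rewrite gt_eqF.
  have := H t; rewrite /E; move: (r t ^+ n.+1) (r t ^+ n) (s t ^+ n.+1).
  move: (q ^+ n.+1) => Q a b d; lra.
have tele T : c / 2 * \sum_(0 <= t < T) r t ^+ n.+1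
    <= Phi 0%N - Phi T + E * \sum_(0 <= t < T) s t ^+ n.+1.
  elim: T => [|T IH]; first by rewrite !big_geq// !mulr0 subrr addr0.
  by rewrite !big_nat_recr//= !mulrDr; have := step T; lra.
exists ((c / 2)^-1 * (Phi 0%N + E)).
  by rewrite mulr_ge0 ?invr_ge0 ?(ltW c2)// addr_ge0.
move=> T; rewrite -mulrA ler_pdivlMl//; apply: le_trans (tele T) _.
have S0 : 0 <= \sum_(0 <= t < T) s t ^+ n.+1.
  by apply: sumr_ge0 => t _; rewrite exprn_ge0.
have := P0 T; have := P0 0%N => p0 pT.
have := mulr_ge0 p0 S0.
lra.
Qed.

(** The floor [kappa * s] turns the alternative into a single recursion for
    [max h (kappa * s)]: once [c] is small, [p - c * p ^ 2] is monotone on the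
    range of the sequence, so that the floor costs only [s ^ 2]. *)
Lemma clipped_sum h s (c kappa C H : R) :
  0 < c -> 0 <= kappa -> 0 <= C -> (forall t, 0 <= h t <= H) ->
  (forall t, [/\ 0 <= s t.+1, s t.+1 <= s t & s t <= 1]) ->
  (forall t, h t.+1 <= h t - c * h t ^+ 2 + C * s t ^+ 2 \/
             h t.+1 <= kappa * s t + C * s t ^+ 2) ->
  exists2 C', 0 <= C' & forall T,
    \sum_(0 <= t < T) h t ^+ 2 <= C' * (1 + \sum_(0 <= t < T) s t ^+ 2).
Proof.
move=> c0 k0 C0 hH sH rec.
have H0 : 0 <= H by have /andP[a b] := hH 0%N; exact: le_trans b.
pose c' := Num.min c (H + 2 * kappa + 1)^-1.
have W0 : 0 < H + 2 * kappa + 1 by lra.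
have c'0 : 0 < c' by rewrite lt_min c0 invr_gt0.
have c'c : c' <= c by rewrite ge_min lexx.
have c'W : c' * (H + 2 * kappa + 1) <= 1.
  by rewrite -ler_pdivlMr// div1r ge_min lexx orbT.
pose p t := Num.max (h t) (kappa * s t).
have s0 t : 0 <= s t by have [a b _] := sH t; exact: le_trans b.
have ks0 t : 0 <= kappa * s t by rewrite mulr_ge0.
have ks1 t : kappa * s t <= kappa by rewrite ler_piMr//; case: (sH t).
have hp t : h t <= p t by rewrite le_max lexx.
have kp t : kappa * s t <= p t by rewrite le_max lexx orbT.
have p0 t : 0 <= p t by exact: le_trans (kp t).
have pE t : p t = h t \/ p t = kappa * s t.
  by rewrite /p maxEle; case: ifP; [right|left].
pose E := C + c' * kappa ^+ 2.
have q0 : 0 <= c' * kappa ^+ 2 by rewrite mulr_ge0 ?sqr_ge0 ?(ltW c'0).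
have E0 : 0 <= E by rewrite addr_ge0.
have floor t : kappa * s t <= p t - c' * p t ^+ 2 + c' * kappa ^+ 2 * s t ^+ 2.
  have pH : p t + kappa * s t <= H + 2 * kappa + 1.
    have /andP[_ hH1] := hH t; have := ks1 t; case: (pE t) => ->; lra.
  have : c' * (p t + kappa * s t) <= 1.
    by apply: le_trans c'W; rewrite ler_wpM2l// ltW.
  move: (kp t); rewrite -subr_ge0 => kp' kc.
  have : 0 <= (p t - kappa * s t) * (1 - c' * (p t + kappa * s t)).
    by rewrite mulr_ge0// subr_ge0.
  lra.
have step t : p t.+1 <= p t - c' * p t ^+ 2 + E * s t ^+ 2.
  have sq0 : 0 <= C * s t ^+ 2 by rewrite mulr_ge0 ?sqr_ge0.
  have qs0 : 0 <= c' * kappa ^+ 2 * s t ^+ 2 by rewrite mulr_ge0 ?sqr_ge0.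
  have fl := floor t.
  rewrite ge_max /E; apply/andP; split; last first.
    have [_ sd _] := sH t; have := ler_wpM2l k0 sd; lra.
  case: (rec t) => rt; last lra.
  have := ler_wpM2r (sqr_ge0 (h t)) c'c.
  case: (pE t) => pEt; first by rewrite pEt; lra.
  have := hp t; have : 0 <= c * h t ^+ 2 by rewrite mulr_ge0 ?sqr_ge0 ?(ltW c0).
  lra.
have step1 t :
    p t.+1 <= p t - c' * p t ^+ 2 + E * s t * p t ^+ 1 + E * s t ^+ 2.
  have : 0 <= E * s t * p t by rewrite !mulr_ge0.
  by rewrite expr1; have := step t; lra.
have [C' C'0 HC'] := potential_sum c'0 E0 p0 p0 s0 step1.
exists C' => // T; apply: le_trans (HC' T); apply: ler_sum => t _.
by have /andP[h0 _] := hH t; rewrite lerXn2r ?nnegrE.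
Qed.

End Rates.

(** * The payoff, its best responses and its gaps *)

Section Payoff.
Variables (R : realType) (dx dy : nat).
Variables (X : set 'rV[R]_dx) (Y : set 'rV[R]_dy).
Variable L : 'rV[R]_dx -> 'rV[R]_dy -> R.
Variables (mu Lxx Lyx Lyy : R).
Hypothesis Lcc : convex_concave X Y L.
Hypothesis sa : standing_assumption X Y L mu Lxx Lyx Lyy.

Implicit Types (x v : 'rV[R]_dx) (y u w : 'rV[R]_dy).

Lemma differentiable_payoff_x x y : X x -> Y y ->
  differentiable (fun x' => L x' y) x.
Proof.
move=> Xx Yy; have [U [_ XYU C1]] := sa_C1 sa.
have Uxy : U (x, y) by apply: XYU.
have [dL _] := C1 _ Uxy.
have dp : differentiable (fun x' => (x', y)) x by exact: differentiable_pair.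
exact: (differentiable_comp dp dL).
Qed.

Lemma differentiable_payoff_y x y : X x -> Y y -> differentiable (L x) y.
Proof.
move=> Xx Yy; have [U [_ XYU C1]] := sa_C1 sa.
have Uxy : U (x, y) by apply: XYU.
have [dL _] := C1 _ Uxy.
have dp : differentiable (fun y' => (x, y')) y by exact: differentiable_pair.
exact: (differentiable_comp dp dL).
Qed.

Lemma grad_x_le x x' y : X x -> X x' -> Y y ->
  dot (grad_x L x y) (x' - x) <= L x' y - L x y.
Proof.
move=> Xx Xx' Yy; apply: (convex_grad_le (S := X)) => //.
- exact: Lcc.1.
- exact: differentiable_payoff_x.
Qed.

Lemma grad_y_ge x y y' : X x -> Y y -> Y y' ->
  L x y' - L x y <= dot (grad_y L x y) (y' - y).
Proof.
move=> Xx Yy Yy'; have dL := differentiable_payoff_y Xx Yy.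
have := convex_grad_le (Lcc.2 x Xx) (differentiableN dL) Yy Yy'.
suff -> : grad (fun u => - L x u) y = - grad_y L x y.
  by rewrite dotNl; lra.
apply/rowP => j; rewrite !mxE.
by rewrite (deriveN (f := L x)) //; exact: diff_derivable.
Qed.

Definition best_response x y := argmin Y (fun u => - L x u) y.

Lemma best_response_ex x : X x -> exists y, best_response x y.
Proof.
move=> Xx.
have [|y yY ymax] :=
    @EVT_max_rV R dy (L x) Y (sa_Y_nonempty sa) (sa_Y_compact sa).
  apply: continuous_in_subspaceT => y /set_mem Yy.
  exact/differentiable_continuous/differentiable_payoff_y.
exists y; split; first exact/set_mem.
by move=> u Yu; rewrite lerN2 ymax//; exact/mem_set.
Qed.

Lemma primalE x y : best_response x y -> primal Y L x = L x y.
Proof.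
move=> [Yy ymax]; apply/eqP; rewrite eq_le; apply/andP; split.
  apply: ge_sup; first by exists (L x y), y.
  by move=> _ [u Yu <-]; have := ymax u Yu; rewrite lerN2.
apply: ub_le_sup; last by exists y.
by exists (L x y) => _ [u Yu <-]; have := ymax u Yu; rewrite lerN2.
Qed.

Lemma primal_ge x y : X x -> Y y -> L x y <= primal Y L x.
Proof.
move=> Xx Yy; have [y' by'] := best_response_ex Xx.
by rewrite (primalE by') -lerN2; exact: by'.2.
Qed.

Lemma gap_YE x y : gap_Y Y L x y = primal Y L x - L x y.
Proof. by []. Qed.

Lemma gap_Y_ge0 x y : X x -> Y y -> 0 <= gap_Y Y L x y.
Proof. by move=> Xx Yy; rewrite gap_YE subr_ge0 primal_ge. Qed.

Lemma payoff_bounds : exists D G : R, [/\ 0 < D, 0 < G,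
  forall x x', X x -> X x' -> enorm (x - x') <= D,
  forall y y', Y y -> Y y' -> enorm (y - y') <= D &
  forall x y, X x -> Y y ->
    enorm (grad_x L x y) <= G /\ enorm (grad_y L x y) <= G].
Proof.
have [x0 Xx0] := sa_X_nonempty sa; have [y0 Yy0] := sa_Y_nonempty sa.
have [D1 D10 HX] := compact_ediam (sa_X_compact sa).
have [D2 D20 HY] := compact_ediam (sa_Y_compact sa).
have Lxx0 := sa_Lxx_ge0 sa; have Lyy0 := sa_Lyy_ge0 sa.
have Lyx0 := ltW (sa_Lyx_gt0 sa).
pose D := D1 + D2.
have HX' x x' : X x -> X x' -> enorm (x - x') <= D.
  by move=> Xx Xx'; apply: le_trans (HX _ _ Xx Xx') _; rewrite /D; lra.
have HY' y y' : Y y -> Y y' -> enorm (y - y') <= D.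
  by move=> Yy Yy'; apply: le_trans (HY _ _ Yy Yy') _; rewrite /D; lra.
pose g1 := enorm (grad_x L x0 y0); pose g2 := enorm (grad_y L x0 y0).
have D0 : 0 <= D by rewrite /D; lra.
have p1 : 0 <= Lxx * D by rewrite mulr_ge0.
have p2 : 0 <= Lyx * D by rewrite mulr_ge0.
have p3 : 0 <= Lyy * D by rewrite mulr_ge0.
have g10 : 0 <= g1 := enorm_ge0 _; have g20 : 0 <= g2 := enorm_ge0 _.
exists D, (g1 + g2 + Lxx * D + 2 * (Lyx * D) + Lyy * D + 1); split => //.
- by rewrite /D; lra.
- lra.
move=> x y Xx Yy; split.
  have -> : grad_x L x y = grad_x L x y - grad_x L x0 y0 + grad_x L x0 y0.
    by rewrite subrK.
  apply: le_trans (enormD _ _) _; rewrite -/g1.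
  have := sa_grad_x sa Xx Yy Xx0 Yy0.
  have := ler_wpM2l Lxx0 (HX' _ _ Xx Xx0).
  have := ler_wpM2l Lyx0 (HY' _ _ Yy Yy0).
  lra.
have -> : grad_y L x y = grad_y L x y - grad_y L x0 y0 + grad_y L x0 y0.
  by rewrite subrK.
apply: le_trans (enormD _ _) _; rewrite -/g2.
have := sa_grad_y sa Xx Yy Xx0 Yy0.
have := ler_wpM2l Lyx0 (HX' _ _ Xx Xx0).
have := ler_wpM2l Lyy0 (HY' _ _ Yy Yy0).
lra.
Qed.

Lemma gap_Y_bounded : exists2 H, 0 < H &
  forall x y, X x -> Y y -> gap_Y Y L x y <= H.
Proof.
have [D [G [D0 G0 _ HY HG]]] := payoff_bounds.
exists (G * D); first by rewrite mulr_gt0.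
move=> x y Xx Yy; have [y' by'] := best_response_ex Xx.
rewrite gap_YE (primalE by'); apply: le_trans (grad_y_ge Xx Yy by'.1) _.
apply: le_trans (cauchy_schwarz _ _) _.
apply: ler_pM; rewrite ?enorm_ge0//; first by case: (HG _ _ Xx Yy).
by apply: HY => //; exact: by'.1.
Qed.

Lemma has_inf_primal : has_inf [set primal Y L v | v in X].
Proof.
have [x0 Xx0] := sa_X_nonempty sa; have [y0 Yy0] := sa_Y_nonempty sa.
have [D [G [D0 G0 HX _ HG]]] := payoff_bounds.
split; first by exists (primal Y L x0), x0.
exists (L x0 y0 - G * D) => _ [v Xv <-].
apply: le_trans (primal_ge Xv Yy0).
have := grad_x_le Xx0 Xv Yy0; have := cauchy_schwarzN (grad_x L x0 y0) (v - x0).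
have : enorm (grad_x L x0 y0) * enorm (v - x0) <= G * D.
  by apply: ler_pM; rewrite ?enorm_ge0//; [case: (HG _ _ Xx0 Yy0)|exact: HX].
lra.
Qed.

Lemma gap_opt_ge0 x : X x -> 0 <= gap_opt X Y L x.
Proof.
move=> Xx; rewrite subr_ge0; apply: ge_inf; last by exists x.
exact: has_inf_primal.2.
Qed.

(** Convexity in [x] bounds the increase by the slope at the far end, which the
    Lipschitz condition compares with the slope at the near end. *)
Lemma payoff_increase x x' y y' : X x -> X x' -> Y y -> Y y' ->
  L x' y' - L x y' <= dot (grad_x L x y) (x' - x)
    + (Lxx * enorm (x' - x) + Lyx * enorm (y' - y)) * enorm (x' - x).
Proof.
move=> Xx Xx' Yy Yy'.
have := grad_x_le Xx' Xx Yy'.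
have := cauchy_schwarz (grad_x L x' y' - grad_x L x y) (x' - x).
have := ler_wpM2r (enorm_ge0 (x' - x)) (sa_grad_x sa Xx' Yy' Xx Yy).
rewrite !dotL; lra.
Qed.

Lemma primal_step x x' y y' : X x -> X x' -> Y y -> best_response x' y' ->
  primal Y L x' <= primal Y L x + dot (grad_x L x y) (x' - x)
    + (Lxx * enorm (x' - x) + Lyx * enorm (y' - y)) * enorm (x' - x).
Proof.
move=> Xx Xx' Yy by'; rewrite (primalE by').
have := payoff_increase Xx Xx' Yy by'.1; have := primal_ge Xx by'.1; lra.
Qed.

(** The change of the gap is at most the difference of two changes of payoff,
    at the best response and at [y], in which the linear part cancels. *)
Lemma gap_Y_step x x' y y' : X x -> X x' -> Y y -> best_response x' y' ->
  gap_Y Y L x' y <= gap_Y Y L x y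
    + (Lxx * enorm (x' - x) + Lyx * enorm (y' - y)) * enorm (x' - x).
Proof.
move=> Xx Xx' Yy by'; rewrite !gap_YE.
have := primal_step Xx Xx' Yy by'; have := grad_x_le Xx Xx' Yy; lra.
Qed.

(** Strong concavity at the midpoint of [y] and [y'] suffices, at the price of
    the constant [mu / 4] instead of [mu / 2]. *)
Lemma gap_Y_strong x y y' : X x -> Y y -> best_response x y' ->
  mu / 4 * enorm (y' - y) ^+ 2 <= gap_Y Y L x y.
Proof.
move=> Xx Yy by'; have Yy' := by'.1.
have h : 0 <= (2^-1 : R) <= 1 by apply/andP; split; lra.
have := sa_concave sa Xx Yy' Yy h.
have := primal_ge Xx (convex_set_comb (sa_Y_convex sa) Yy' Yy h).
by rewrite gap_YE (primalE by'); lra.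
Qed.

(** Quadratic growth makes the best response nearly Lipschitz: the distance to
    it is controlled by the gap before the move and the length of the move. *)
Lemma best_response_dist : 0 < mu -> exists2 C, 0 < C &
  forall x x' y y', X x -> X x' -> Y y -> best_response x' y' ->
    enorm (y' - y) ^+ 2 <= C * (gap_Y Y L x y + enorm (x' - x) ^+ 2).
Proof.
move=> mu0; have Lxx0 := sa_Lxx_ge0 sa; have Lyx0 := sa_Lyx_gt0 sa.
pose K := Lxx + 2 * Lyx ^+ 2 / mu + 1.
have q0 : 0 <= Lyx ^+ 2 / mu by rewrite divr_ge0 ?sqr_ge0// ltW.
have K1 : 1 <= K by rewrite /K; lra.
exists (8 / mu * K); first by rewrite mulr_gt0 ?divr_gt0//; lra.
move=> x x' y y' Xx Xx' Yy by'.
have := gap_Y_strong Xx' Yy by'; have := gap_Y_step Xx Xx' Yy by'.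
have := gap_Y_ge0 Xx Yy.
move: (gap_Y _ _ x y) (gap_Y _ _ x' y) (enorm (x' - x)) (enorm (y' - y)).
move=> h h' d e h0 H1 H2.
have H3 : Lyx * e * d <= mu / 8 * e ^+ 2 + 2 * Lyx ^+ 2 / mu * d ^+ 2.
  rewrite -subr_ge0 (_ : _ - _ = mu / 8 * (e - 4 * Lyx * d / mu) ^+ 2).
    by rewrite mulr_ge0 ?sqr_ge0// divr_ge0// ltW.
  by field; rewrite gt_eqF.
have -> : e ^+ 2 = 8 / mu * (mu / 8 * e ^+ 2) by field; rewrite gt_eqF.
rewrite -(mulrA _ K) ler_wpM2l ?divr_ge0 ?(ltW mu0)//.
have -> : K * (h + d ^+ 2)
    = (K - 1) * h + h + (Lxx + 2 * Lyx ^+ 2 / mu + 1) * d ^+ 2.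
  by rewrite /K; ring.
have K1h : 0 <= (K - 1) * h by rewrite mulr_ge0// subr_ge0.
by have := sqr_ge0 d; lra.
Qed.

End Payoff.

(** * Progress of one conditional gradient step *)

Section FrankWolfe.
Variables (R : realType) (dx dy : nat).
Variables (X : set 'rV[R]_dx) (Y : set 'rV[R]_dy).
Variable L : 'rV[R]_dx -> 'rV[R]_dy -> R.
Variables (mu Lxx Lyx Lyy : R).
Hypothesis Lcc : convex_concave X Y L.
Hypothesis sa : standing_assumption X Y L mu Lxx Lyx Lyy.

Implicit Types (x : 'rV[R]_dx) (y u : 'rV[R]_dy).

Lemma grad_regularized beta y0 x y : X x -> Y y ->
  grad_y (regularized L y0 beta) x y = grad_y L x y - beta *: (y - y0).
Proof.
move=> Xx Yy; apply/rowP => j; rewrite !mxE.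
have dL : derivable (L x) y (delta_mx 0 j).
  exact/diff_derivable/(differentiable_payoff_y sa).
have [dq qE] := is_derive_sqnorm (beta / 2) y y0 (delta_mx 0 j).
rewrite (deriveB dL dq) qE.
rewrite mulrCA divff ?mulr1 ?pnatr_eq0// dotE.
rewrite (bigD1 j)//= big1 ?addr0; last first.
  by move=> i ij; rewrite [X in _ * X]mxE (negbTE ij) andbF mulr0.
by rewrite !mxE !eqxx mulr1.
Qed.

(** Two half steps of the concave gradient inequality: they lose the constant
    [3 / 4] where integration would give [1 / 2], which still leaves a quarter
    of the linear gain at the short step. *)
Lemma payoff_ascent x y u (a : R) : X x -> Y y -> Y u -> 0 <= a <= 1 ->
  a * dot (grad_y L x y) (u - y) - 3 / 4 * (Lyy * a ^+ 2 * enorm (u - y) ^+ 2)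
    <= L x (y + a *: (u - y)) - L x y.
Proof.
move=> Xx Yy Yu /andP[a0 a1]; set e := u - y.
have seg (t : R) : 0 <= t <= 1 -> Y (y + t *: e).
  exact: convex_set_segment (sa_Y_convex sa) Yy Yu.
have Y2 : Y (y + a *: e) by apply: seg; rewrite a0.
have Y1 : Y (y + (a / 2) *: e) by apply: seg; apply/andP; split; lra.
have slope (t : R) : 0 <= t -> Y (y + t *: e) ->
    dot (grad_y L x y) e - Lyy * t * enorm e ^+ 2
      <= dot (grad_y L x (y + t *: e)) e.
  move=> t0 Yt; have := sa_grad_y sa Xx Yt Xx Yy.
  rewrite subrr enorm0 mulr0 add0r addrAC subrr add0r enormZ// => lip.
  have := cauchy_schwarzN (grad_y L x (y + t *: e) - grad_y L x y) e.
  have := ler_wpM2r (enorm_ge0 e) lip.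
  by rewrite !dotL; lra.
have := grad_y_ge Lcc sa Xx Y1 Yy; have := grad_y_ge Lcc sa Xx Y2 Y1.
have -> : y + (a / 2) *: e - (y + a *: e) = - (a / 2) *: e.
  by rewrite opprD addrACA subrr add0r -scalerBl; congr (_ *: _); field.
have -> : y - (y + (a / 2) *: e) = - (a / 2) *: e.
  by rewrite opprD addrA subrr add0r scaleNr.
have a20 : 0 <= a / 2 by lra.
have := ler_wpM2l a20 (slope _ a20 Y1).
have := ler_wpM2l a20 (slope _ a0 Y2).
rewrite !dotZr; lra.
Qed.

(** The maximizer of the model [a * g - M * d ^ 2 * a ^ 2 / 2] of the gain,
    clipped at 1; for [d = 0] the quotient is 0. *)
Definition short_step (M g d : R) : R := Num.min (g / (M * d ^+ 2)) 1.

Lemma short_stepP (M g d : R) : 0 <= M -> 0 <= g -> (d = 0 -> g = 0) ->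
  [/\ 0 <= short_step M g d <= 1, short_step M g d * (M * d ^+ 2) <= g &
      0 < M -> short_step M g d = 1 \/ g = short_step M g d * (M * d ^+ 2)].
Proof.
move=> M0 g0 d0; rewrite /short_step; set q := M * d ^+ 2.
have q0 : 0 <= q by rewrite mulr_ge0// sqr_ge0.
have gq0 : 0 <= g / q by rewrite divr_ge0.
have minE : Num.min (g / q) 1 = 1 \/ Num.min (g / q) 1 = g / q.
  by rewrite minEle; case: ifP; [right|left].
split.
- by rewrite le_min gq0 ler01 ge_min lexx orbT.
- have [->|qn0] := eqVneq q 0; first by rewrite mulr0.
  apply: (@le_trans _ _ (g / q * q)); last by rewrite divfK.
  by rewrite ler_wpM2r// ge_min lexx.
- move=> Mp; have [qe0|qn0] := eqVneq q 0; last first.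
    by case: minE => ->; [left|right; rewrite divfK].
  right; rewrite qe0 mulr0 d0//.
  by move/eqP: qe0; rewrite mulf_eq0 gt_eqF//= expf_eq0 => /eqP.
Qed.

Lemma lmo_best p y u w : LMO Y (- p) u -> Y w ->
  dot p (w - y) <= dot p (u - y).
Proof. by move=> lmo Yw; have := lmo.2 w Yw; rewrite !dotL; lra. Qed.

Section Step.
Variables (x : 'rV[R]_dx) (y0 y u : 'rV[R]_dy) (beta : R).
Hypotheses (Xx : X x) (Yy0 : Y y0) (Yy : Y y) (beta0 : 0 <= beta).
Let p := grad_y (regularized L y0 beta) x y.
Hypothesis LMOu : LMO Y (- p) u.
Let g := dot p (u - y).
Let a := short_step (Lyy + beta) g (enorm (u - y)).
Variable D : R.
Hypothesis HD : forall y y', Y y -> Y y' -> enorm (y - y') <= D.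

Lemma regularized_slope w :
  dot p w = dot (grad_y L x y) w - beta * dot (y - y0) w.
Proof. by rewrite /p grad_regularized// dotDl dotNl dotZl. Qed.

Lemma fw_gap_ge0 : 0 <= g.
Proof.
have := lmo_best y LMOu Yy; rewrite -/g.
by rewrite subrr dotC /dot mul0mx mxE.
Qed.

Lemma fw_stepP : [/\ 0 <= a <= 1, a * ((Lyy + beta) * enorm (u - y) ^+ 2) <= g &
  0 < Lyy + beta -> a = 1 \/ g = a * ((Lyy + beta) * enorm (u - y) ^+ 2)].
Proof.
apply: short_stepP; first by rewrite addr_ge0// (sa_Lyy_ge0 sa).
  exact: fw_gap_ge0.
by move/enorm_eq0 => uy; rewrite /g uy dotC /dot mul0mx mxE.
Qed.

Lemma fw_mem : Y (y + a *: (u - y)).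
Proof.
have [a01 _ _] := fw_stepP.
exact: convex_set_segment (sa_Y_convex sa) Yy LMOu.1 a01.
Qed.

Lemma regularizer_slope y' : Y y' -> `|dot (y - y0) (y' - y)| <= D ^+ 2.
Proof.
move=> Yy'; have b : enorm (y - y0) * enorm (y' - y) <= D ^+ 2.
  by rewrite expr2 ler_pM ?enorm_ge0// HD.
rewrite ler_norml; apply/andP; split.
  by have := cauchy_schwarzN (y - y0) (y' - y); lra.
by have := cauchy_schwarz (y - y0) (y' - y); lra.
Qed.

Lemma gap_Y_le_fw_gap : gap_Y Y L x y <= g + beta * D ^+ 2.
Proof.
have [y' by'] := best_response_ex sa Xx; have Yy' := by'.1.
have := grad_y_ge Lcc sa Xx Yy Yy'; have := lmo_best y LMOu Yy'; rewrite -/g.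
have := regularizer_slope Yy'; rewrite ler_norml => /andP[_ H].
have := ler_wpM2l beta0 H.
rewrite gap_YE (primalE by') regularized_slope; lra.
Qed.

(** The gain in the original payoff: the regularizer tilts the direction of
    ascent, but its slope along [u - y] is at most [D ^ 2]. *)
Lemma fw_progress :
  a * (g / 4 - beta * D ^+ 2) <= L x (y + a *: (u - y)) - L x y.
Proof.
have [a01 ag _] := fw_stepP; have /andP[a0 a1] := a01.
have := payoff_ascent Xx Yy LMOu.1 a01.
have : a * dot (grad_y L x y) (u - y)
    = a * g + a * (beta * dot (y - y0) (u - y)).
  by rewrite /g regularized_slope; ring.
have := regularizer_slope LMOu.1; rewrite ler_norml => /andP[H _].
have := ler_wpM2l a0 (ler_wpM2l beta0 H).
have := ler_wpM2l a0 ag.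
have : 0 <= a * (a * (beta * enorm (u - y) ^+ 2)).
  by do 3 apply: mulr_ge0 => //; exact: sqr_ge0.
lra.
Qed.

End Step.

End FrankWolfe.

Section Progress.
Variables (R : realType) (dx dy : nat).
Variables (X : set 'rV[R]_dx) (Y : set 'rV[R]_dy).
Variable L : 'rV[R]_dx -> 'rV[R]_dy -> R.
Variables (mu Lxx Lyx Lyy : R).
Hypothesis Lcc : convex_concave X Y L.
Hypothesis sa : standing_assumption X Y L mu Lxx Lyx Lyy.

Implicit Types (x : 'rV[R]_dx) (y u : 'rV[R]_dy).

Definition fw_next (y0 : 'rV[R]_dy) beta x y u : 'rV[R]_dy :=
  let g := dot (grad_y (regularized L y0 beta) x y) (u - y) in
  y + short_step (Lyy + beta) g (enorm (u - y)) *: (u - y).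

Definition fw_oracle (y0 : 'rV[R]_dy) beta x y u : Prop :=
  [/\ X x, Y y0, Y y & LMO Y (- grad_y (regularized L y0 beta) x y) u].

Lemma gap_Y_change x y y' :
  gap_Y Y L x y' = gap_Y Y L x y - (L x y' - L x y).
Proof. by rewrite !gap_YE; ring. Qed.

(** The gap of the original payoff satisfies an alternative. Above the level
    [K * beta] the tilt due to the regularizer is a fraction of the gain, which
    is quadratic in the gap when the step is not clipped. Below it a full step
    along the tilted direction loses at most [beta * D ^ 2]. *)
Lemma fw_quadratic (M : R) : exists c K : R, [/\ 0 < c, 0 <= K &
  forall y0 beta x y u, 0 <= beta -> 0 < Lyy + beta <= M ->
    fw_oracle y0 beta x y u ->
    let h := gap_Y Y L x y in
    let h' := gap_Y Y L x (fw_next y0 beta x y u) in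
    (K * beta <= h -> h' <= h - c * h ^+ 2) /\
    (h <= K * beta -> h' <= 2 * K * beta)].
Proof.
have [D [G [D0 G0 _ HD _]]] := payoff_bounds sa.
have [H H0 HH] := gap_Y_bounded Lcc sa.
pose N := `|M| * D ^+ 2.
have N0 : 0 <= N by rewrite mulr_ge0// sqr_ge0.
have W0 : 0 < 16 * H + 32 * N by lra.
exists (16 * H + 32 * N)^-1, (9 * D ^+ 2); split.
- by rewrite invr_gt0.
- by rewrite mulr_ge0// sqr_ge0.
move=> y0 beta x y u b0 /andP[M0 MM] [Xx Yy0 Yy lmo] h h'.
have h0 : 0 <= h := gap_Y_ge0 sa Xx Yy.
have hH : h <= H := HH _ _ Xx Yy.
have := fw_progress Lcc sa Xx Yy0 Yy b0 lmo HD.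
have := gap_Y_le_fw_gap Lcc sa Xx Yy0 Yy b0 lmo HD.
have := fw_gap_ge0 Yy lmo.
have [a01 _ /(_ M0)] := fw_stepP sa Yy b0 lmo.
have : h' = h - (L x (fw_next y0 beta x y u) - L x y) := gap_Y_change _ _ _.
rewrite /fw_next; move: a01.
set g := dot _ (u - y); set a := short_step _ _ _.
set l' := L x _; rewrite -/h => /andP[a0 a1] -> aE g0 hg prog.
have dD : (Lyy + beta) * enorm (u - y) ^+ 2 <= N.
  apply: ler_pM; rewrite ?sqr_ge0 ?(ltW M0)//.
    by apply: le_trans MM _; exact: ler_norm.
  rewrite lerXn2r ?nnegrE ?enorm_ge0 ?(ltW D0)//; apply: HD => //; exact: lmo.1.
have bD : 0 <= beta * D ^+ 2 by rewrite mulr_ge0// sqr_ge0.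
split=> hK; last by have := mulr_ge0 a0 g0; have := ler_wpM2r bD a1; lra.
have gh : h / 2 <= g by lra.
have ag : a * (g / 8) <= a * (g / 4 - beta * D ^+ 2).
  by apply: ler_wpM2l => //; lra.
suff : (16 * H + 32 * N)^-1 * h ^+ 2 <= a * (g / 8) by lra.
rewrite ler_pdivrMl//.
have hh : h ^+ 2 <= h * H by rewrite expr2 ler_wpM2l.
have [aE1|gE] := aE.
  have : 0 <= N * g by rewrite mulr_ge0.
  have := ler_wpM2r (ltW H0) gh.
  rewrite aE1; lra.
have : g ^+ 2 <= a * g * N.
  rewrite expr2 {1}gE mulrAC ler_wpM2l//; exact: mulr_ge0.
have : h ^+ 2 <= 4 * g ^+ 2.
  have -> : 4 * g ^+ 2 = (2 * g) ^+ 2 by ring.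
  by rewrite lerXn2r ?nnegrE//; lra.
have : 0 <= a * g * H by rewrite !mulr_ge0// ltW.
lra.
Qed.

(** Strong concavity forces [mu <= 4 * Lyy] as soon as [Y] has two points; this
    covers the case in which the short step has a zero denominator. *)
Lemma gap_Y_degenerate x y : 0 < mu -> Lyy <= 0 -> X x -> Y y ->
  gap_Y Y L x y = 0.
Proof.
move=> mu0 Lyy0 Xx Yy; have [y' by'] := best_response_ex sa Xx.
have Yy' := by'.1.
suff : enorm (y' - y) ^+ 2 <= 0.
  rewrite real_exprn_even_le0 ?num_real//= => /eqP/enorm_eq0/eqP.
  by rewrite subr_eq0 => /eqP <-; rewrite gap_YE (primalE by') subrr.
have h : 0 <= (2^-1 : R) <= 1 by apply/andP; split; lra.
have := sa_concave sa Xx Yy' Yy h.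
have Ym := convex_set_comb (sa_Y_convex sa) Yy' Yy h.
have := grad_y_ge Lcc sa Xx Yy Ym; have := grad_y_ge Lcc sa Xx Yy' Yy.
have -> : 2^-1 *: y' + (1 - 2^-1) *: y - y = 2^-1 *: (y' - y).
  by rewrite scalerBl scale1r addrA addrAC addrK scalerBr.
have := sa_grad_y sa Xx Yy Xx Yy'.
rewrite subrr enorm0 mulr0 add0r (enormBC y y') => lip.
have := ler_wpM2r (enorm_ge0 (y' - y)) lip.
have := cauchy_schwarz (grad_y L x y - grad_y L x y') (y' - y).
have e0 := sqr_ge0 (enorm (y' - y)).
have := ler_wpM2r e0 Lyy0.
rewrite mul0r -(opprB y' y) dotDl dotNl dotZr dotNr => H1 H2 H3 H4 H5 H6.
have : mu * enorm (y' - y) ^+ 2 <= 0 by lra.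
by rewrite pmulr_rle0.
Qed.

Lemma fw_mem_next y0 beta x y u : 0 <= beta -> fw_oracle y0 beta x y u ->
  Y (fw_next y0 beta x y u).
Proof. by move=> b0 [Xx Yy0 Yy lmo]; exact: (fw_mem sa). Qed.

Lemma fw_quadratic_strong : 0 < mu -> exists2 c : R, 0 < c &
  forall y0 x y u, fw_oracle y0 0 x y u ->
    gap_Y Y L x (fw_next y0 0 x y u)
      <= gap_Y Y L x y - c * gap_Y Y L x y ^+ 2.
Proof.
move=> mu0; have [c [K [c0 K0 HK]]] := fw_quadratic Lyy.
exists c => // y0 x y u ora; have [Xx Yy0 Yy lmo] := ora.
have [Lyy0|Lyy0] := leP Lyy 0.
  rewrite !gap_Y_degenerate//; first by rewrite expr0n mulr0 subr0.
  exact: fw_mem_next.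
have [] := HK y0 0 x y u (lexx _) _ ora; first by rewrite addr0 Lyy0/=.
by move=> + _; apply; rewrite mulr0 (gap_Y_ge0 sa).
Qed.

(** On a strongly convex set the linear oracle gains, beyond the midpoint of
    [y] and [u], a ball of radius [alpha / 8 * enorm (u - y) ^+ 2]. *)
Lemma lmo_strongly_convex (alpha : R) p y u : strongly_convex_set alpha Y ->
  Y y -> LMO Y (- p) u ->
  alpha / 4 * enorm (u - y) ^+ 2 * enorm p <= dot p (u - y).
Proof.
move=> sc Yy lmo; have := lmo_best y lmo.
have [p0|p0] := eqVneq (enorm p) 0.
  by rewrite p0 mulr0 (enorm_eq0 p0) /dot mul0mx mxE.
have pp : 0 < enorm p by rewrite lt_def p0 enorm_ge0.
have h : 0 <= (2^-1 : R) <= 1 by apply/andP; split; lra.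
have zn : enorm ((enorm p)^-1 *: p) = 1.
  by rewrite enormZ ?invr_ge0 ?(ltW pp)// mulVf.
move=> /(_ _ (sc _ _ _ _ lmo.1 Yy zn h)).
rewrite !dotL -enorm_sqr.
have -> : (enorm p)^-1 * enorm p ^+ 2 = enorm p by field.
lra.
Qed.

(** By the preceding lemma an unclipped short step has a size at least
    proportional to the norm of the gradient, hence, by strong concavity, to the
    square root of the gap; it gains this proportion of the gap. *)
Lemma fw_cubic (alpha : R) :
  0 < mu -> 0 < alpha -> strongly_convex_set alpha Y ->
  exists2 c : R, 0 < c &
  forall y0 x y u (r : R), fw_oracle y0 0 x y u ->
    0 <= r -> r ^+ 2 = gap_Y Y L x y ->
    gap_Y Y L x (fw_next y0 0 x y u) <= gap_Y Y L x y - c * r ^+ 3.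
Proof.
move=> mu0 alpha0 sc.
have [D [G [D0 G0 _ HD _]]] := payoff_bounds sa.
have [H H0 HH] := gap_Y_bounded Lcc sa.
have [Lyy0|Lyy0] := leP Lyy 0.
  exists 1 => // y0 x y u r ora r0; have [Xx Yy0 Yy lmo] := ora.
  rewrite !gap_Y_degenerate//; last exact: fw_mem_next.
  by move=> /eqP; rewrite expf_eq0/= => /eqP ->; rewrite expr0n mulr0 subr0.
pose s := Num.sqrt mu; have s0 : 0 < s by rewrite sqrtr_gt0.
have sE : s ^+ 2 = mu by rewrite sqr_sqrtr// ltW.
pose c1 := alpha * s / (32 * Lyy).
have c10 : 0 < c1 by rewrite divr_gt0 ?mulr_gt0.
pose c2 := (4 * (H + 1))^-1.
have c20 : 0 < c2 by rewrite invr_gt0; lra.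
exists (Num.min c1 c2); first by rewrite lt_min c10.
move=> y0 x y u r ora r0 rE; have [Xx Yy0 Yy lmo] := ora.
have r30 : 0 <= r ^+ 3 by rewrite exprn_ge0.
have [y' by'] := best_response_ex sa Xx; have Yy' := by'.1.
have hH : r ^+ 2 <= H by rewrite rE HH.
have := gap_Y_strong sa Xx Yy by'; rewrite -rE => strong.
have := fw_progress Lcc sa Xx Yy0 Yy (lexx 0) lmo HD.
have := gap_Y_le_fw_gap Lcc sa Xx Yy0 Yy (lexx 0) lmo HD.
have := fw_gap_ge0 Yy lmo.
have [a01 _] := fw_stepP sa Yy (lexx 0) lmo.
have Lyy00 : 0 < Lyy + 0 by rewrite addr0.
move=> /(_ Lyy00).
rewrite (gap_Y_change x y (fw_next _ _ _ _ _)) /fw_next; move: a01.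
have := lmo_strongly_convex sc Yy lmo.
have := lmo_best y lmo Yy'.
have := cauchy_schwarz (grad_y (regularized L y0 0) x y) (y' - y).
have := grad_y_ge Lcc sa Xx Yy Yy'.
have -> : grad_y L x y = grad_y (regularized L y0 0) x y.
  by rewrite (grad_regularized sa)// scale0r subr0.
move: strong; rewrite -(primalE by') -gap_YE -rE.
set p := grad_y _ x y; set a := short_step _ _ _; set g := dot p (u - y).
rewrite !mul0r !addr0 subr0.
set d := enorm (u - y); set e := enorm (y' - y); set P := enorm p.
move=> strong cs1 cs2 cs3 gP /andP[a0 a1] aE g0 hg prog.
have P0 : 0 <= P := enorm_ge0 _; have e0 : 0 <= e := enorm_ge0 _.
have rP : s * r <= 2 * P.
  have rr : r ^+ 2 <= P * e by lra.
  have se : s * e <= 2 * r.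
    rewrite -ler_sqr ?nnegrE ?mulr_ge0 ?(ltW s0)// !exprMn sE; lra.
  have [->|rn0] := eqVneq r 0; first by rewrite mulr0 mulr_ge0.
  have rp : 0 < r by rewrite lt_def rn0.
  rewrite -(ler_pM2r rp).
  have := ler_wpM2l (ltW s0) rr; have := ler_wpM2l P0 se.
  lra.
suff : Num.min c1 c2 * r ^+ 3 <= a * (g / 4) by lra.
have [a_1|gE] := aE.
  apply: (@le_trans _ _ (c2 * r ^+ 3)).
    by rewrite ler_wpM2r// ge_min lexx orbT.
  rewrite a_1 mul1r /c2 ler_pdivrMl; last lra.
  have r1 : r <= H + 1.
    have := sqr_ge0 (r - 1); lra.
  have : r ^+ 3 <= (H + 1) * r ^+ 2 by rewrite exprS ler_wpM2r// sqr_ge0.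
  have : (H + 1) * r ^+ 2 <= (H + 1) * g by apply: ler_wpM2l; lra.
  lra.
apply: (@le_trans _ _ (c1 * r ^+ 3)); first by rewrite ler_wpM2r// ge_min lexx.
have [d0|dn0] := eqVneq d 0.
  have g00 : g = 0 by rewrite gE d0 expr0n !mulr0.
  have /eqP : r ^+ 2 = 0 by apply/eqP; rewrite eq_le sqr_ge0 andbT; lra.
  by rewrite expf_eq0/= => /eqP ->; rewrite g00 expr0n mul0r !mulr0.
have dp : 0 < d ^+ 2 by rewrite exprn_even_gt0.
have ar : c1 * r <= a / 4.
  rewrite -(ler_pM2r dp) -(ler_pM2r Lyy0).
  have -> : c1 * r * d ^+ 2 * Lyy = alpha / 32 * d ^+ 2 * (s * r).
    by rewrite /c1; field; rewrite gt_eqF.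
  have k0 : 0 <= alpha / 32 * d ^+ 2 by rewrite mulr_ge0 ?sqr_ge0//; lra.
  have := ler_wpM2l k0 rP; lra.
have -> : c1 * r ^+ 3 = c1 * r * r ^+ 2 by ring.
have -> : a * (g / 4) = a / 4 * g by ring.
apply: ler_pM => //; rewrite ?sqr_ge0//; first by rewrite mulr_ge0// ltW.
Qed.

End Progress.

(** * The projected step *)

Section Projection.
Variables (R : realType) (n : nat) (S : set 'rV[R]_n).
Hypothesis cS : convex_set S.
Implicit Types (p q v x : 'rV[R]_n).

Lemma projection_le q p v : PO S q p -> S v -> dot (q - p) (v - p) <= 0.
Proof.
move=> [Sp pmin] Sv; rewrite leNgt; apply/negP.
set w := q - p; set z := v - p => a0.
pose a := dot w z; pose N := dot z z; rewrite -/a in a0.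
have N0 : 0 <= N := dot_ge0 _.
have aN : 0 < a + N by lra.
pose s := a / (a + N).
have s0 : 0 < s by rewrite divr_gt0.
have s1 : s <= 1 by rewrite ler_pdivrMr// mul1r; lra.
have s01 : 0 <= s <= 1 by rewrite ltW.
have := pmin _ (convex_set_segment cS Sp Sv s01).
have -> : q - (p + s *: z) = w - s *: z.
  by rewrite opprD addrA.
rewrite enorm_sqrBZ -/a -/N lerDl => H.
rewrite pmulr_rge0// in H.
have : s * (a + N) = a by rewrite /s divfK// gt_eqF.
have : 0 <= s * a by rewrite mulr_ge0// ltW.
lra.
Qed.

Variables (x x' g : 'rV[R]_n) (tau : R).
Hypotheses (Sx : S x) (po : PO S (x - tau *: g) x').

Lemma projection_three_point v : S v ->
  2 * (tau * dot g (x' - v))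
    <= enorm (x - v) ^+ 2 - enorm (x' - v) ^+ 2 - enorm (x' - x) ^+ 2.
Proof.
move=> Sv; have := projection_le po Sv; rewrite !enorm_sqr !dotL.
rewrite (dotC x' x) (dotC v x) (dotC v x') (dotC x' v) => H; lra.
Qed.

Lemma projection_descent : tau * dot g (x' - x) <= - enorm (x' - x) ^+ 2.
Proof.
have := projection_three_point Sx; rewrite subrr enorm0; lra.
Qed.

Lemma projection_length : 0 <= tau -> enorm (x' - x) <= tau * enorm g.
Proof.
move=> tau0; have := projection_descent.
have := ler_wpM2l tau0 (cauchy_schwarzN g (x' - x)).
have [->|d0] := eqVneq (enorm (x' - x)) 0.
  by move=> *; rewrite mulr_ge0// enorm_ge0.
have dp : 0 < enorm (x' - x) by rewrite lt_def d0 enorm_ge0.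
move=> H1 H2; rewrite -(ler_pM2r dp); lra.
Qed.

End Projection.

(** * Runs of the algorithm *)

Section Run.
Variables (R : realType) (dx dy : nat).
Variables (X : set 'rV[R]_dx) (Y : set 'rV[R]_dy).
Variable L : 'rV[R]_dx -> 'rV[R]_dy -> R.
Variables (mu Lxx Lyx Lyy : R).
Variables (tau beta : nat -> R).
Variables (x : nat -> 'rV[R]_dx) (y u : nat -> 'rV[R]_dy).
Hypothesis Lcc : convex_concave X Y L.
Hypothesis run : PO_LMO X Y L Lyy tau beta x y u.
Hypothesis sa : standing_assumption X Y L mu Lxx Lyx Lyy.
Hypothesis beta0 : forall t, 0 <= beta t.

Local Notation f := (primal Y L).
Local Notation F := (gap_opt X Y L).
Local Notation h := (gap_Y Y L).
Local Notation d t := (enorm (x t.+1 - x t)).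

Lemma x_mem t : X (x t).
Proof. by case: t => [|t]; [exact: pl_x0 run|exact: (pl_x run t).1]. Qed.

Lemma y_next t : y t.+1 = fw_next L Lyy (y 0%N) (beta t) (x t) (y t) (u t).
Proof. exact: pl_y run t. Qed.

Lemma y_mem t : Y (y t).
Proof.
elim: t => [|t Yt]; first exact: pl_y0 run.
rewrite y_next; apply: (fw_mem_next sa) => //; split => //; first exact: x_mem.
- exact: pl_y0 run.
- exact: pl_u run t.
Qed.

Lemma run_oracle t : fw_oracle X Y L (y 0%N) (beta t) (x t) (y t) (u t).
Proof.
by split; [exact: x_mem|exact: y_mem|exact: y_mem|exact: pl_u run t].
Qed.

(** The inequality of the subgradient method evaluated at the new point: the
    dual gap is the error of the subgradient, and the squared length of the move
    left over by the projection is kept to pay for the last term. *)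
Lemma gap_opt_step t y' v : 0 <= tau t -> X v ->
  best_response Y L (x t.+1) y' ->
  tau t * (f (x t.+1) - f v)
    <= (enorm (x t - v) ^+ 2 - enorm (x t.+1 - v) ^+ 2) / 2 - d t ^+ 2 / 2
       + tau t * h (x t) (y t)
       + tau t * ((Lxx * d t + Lyx * enorm (y' - y t)) * d t).
Proof.
move=> t0 Xv by'.
have := ler_wpM2l t0 (primal_step Lcc sa (x_mem t) (x_mem t.+1) (y_mem t) by').
have := projection_three_point (sa_X_convex sa) (pl_x run t) Xv.
have := ler_wpM2l t0 (grad_x_le Lcc sa (x_mem t) Xv (y_mem t)).
have := ler_wpM2l t0 (primal_ge sa Xv (y_mem t)).
by rewrite gap_YE !dotL; lra.
Qed.

(** Convergence of an inexact subgradient method, where [E] stands for the dual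
    gap, which is the error of the subgradient, and for the cost of the move.
    Since [gap_opt] is nonnegative, the step sizes may first be replaced by the
    monotone sequence [W^-1], which bounds them on both sides, before summing by
    parts. *)
Lemma gap_opt_sum (W E : nat -> R) (c1 c2 : R) : 0 < c1 -> 0 < c2 ->
  (forall t, 0 < W t <= W t.+1) ->
  (forall t, c1 / W t <= tau t <= c2 / W t) -> (forall t, 0 <= E t) ->
  (forall t v, X v -> tau t * (f (x t.+1) - f v)
    <= (enorm (x t - v) ^+ 2 - enorm (x t.+1 - v) ^+ 2) / 2 + tau t * E t) ->
  exists2 C, 0 <= C & forall T, \sum_(0 <= t < T.+1) F (x t)
    <= C * (W T + \sum_(0 <= t < T.+1) E t + 1).
Proof.
move=> c10 c20 Wnd tauW E0 step.
have [D [G [D0 G0 HX _ _]]] := payoff_bounds sa.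
have F0 t : 0 <= F (x t) by apply: (gap_opt_ge0 Lcc sa); exact: x_mem.
have W0 t : 0 < W t by case/andP: (Wnd t).
have B0 : 0 <= D ^+ 2 / 2 by rewrite divr_ge0// sqr_ge0.
exists (F (x 0%N) + (D ^+ 2 / 2 + c2) / c1).
  by rewrite addr_ge0// divr_ge0 ?(ltW c10)// addr_ge0// ltW.
(* An almost optimal [v] is enough: its defect, chosen as the inverse of the
   number of terms, adds up to 1. *)
move=> T; pose eps : R := T.+1%:R^-1.
have eps0 : 0 < eps by rewrite invr_gt0.
have [_ [v Xv <-] fv] := inf_adherent eps0 (has_inf_primal Lcc sa).
have key t : c1 * F (x t.+1) <=
    W t * (enorm (x t - v) ^+ 2 / 2 - enorm (x t.+1 - v) ^+ 2 / 2)
    + c2 * (E t + eps).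
  have /andP[ta tb] := tauW t.
  have tau0 : 0 <= tau t by apply: le_trans ta; rewrite divr_ge0// ltW.
  rewrite ler_pdivrMr// in ta; rewrite ler_pdivlMr// in tb.
  apply: le_trans (ler_wpM2r (F0 t.+1) ta) _.
  have Ee : 0 <= E t + eps by rewrite addr_ge0// ltW.
  have := ler_wpM2r Ee tb.
  have := ler_wpM2l (ltW (W0 t)) (step t v Xv).
  have : F (x t.+1) <= f (x t.+1) - f v + eps by rewrite /gap_opt; lra.
  move=> /(ler_wpM2l (mulr_ge0 tau0 (ltW (W0 t)))); lra.
have AB t : 0 <= enorm (x t - v) ^+ 2 / 2 <= D ^+ 2 / 2.
  rewrite divr_ge0 ?sqr_ge0//= ler_pM2r ?invr_gt0//.
  rewrite lerXn2r ?nnegrE ?enorm_ge0 ?(ltW D0)//.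
  by apply: HX => //; exact: x_mem.
have Wm t : 0 <= W t <= W t.+1 by case/andP: (Wnd t) => /ltW -> ->.
have := abel_sum_le AB Wm key T.
rewrite -mulr_sumr.
have -> : \sum_(0 <= t < T.+1) (E t + eps) = \sum_(0 <= t < T.+1) E t + 1.
  rewrite big_split/= sumr_const_nat subn0 -[eps *+ _]mulr_natr.
  by rewrite mulVf ?pnatr_eq0.
set S := \sum_(0 <= t < T.+1) E t; have S0 : 0 <= S by apply: sumr_ge0.
have shift : \sum_(0 <= t < T.+1) F (x t)
    <= F (x 0%N) + \sum_(0 <= t < T.+1) F (x t.+1).
  rewrite big_nat_recl//= lerD2l big_nat_recr//= lerDl//.
move=> H; apply: le_trans shift _.
set S' := \sum_(0 <= t < T.+1) F (x t.+1) in H *.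
have {}H : S' <= (W T * (D ^+ 2 / 2) + c2 * (S + 1)) / c1.
  by rewrite ler_pdivlMr// mulrC.
rewrite mulrDl lerD//.
  by rewrite ler_peMr//; have := W0 T; lra.
apply: le_trans H _; rewrite [leRHS]mulrAC ler_pM2r ?invr_gt0//.
have := mulr_ge0 B0 S0; have := mulr_ge0 (ltW c20) (ltW (W0 T)); lra.
Qed.

End Run.

(** * Rates for concave payoffs *)

Section ConcaveRates.
Variables (R : realType) (dx dy : nat).
Variables (X : set 'rV[R]_dx) (Y : set 'rV[R]_dy).
Variable L : 'rV[R]_dx -> 'rV[R]_dy -> R.
Variables (mu Lxx Lyx Lyy : R).
Variables (tau beta : nat -> R).
Variables (x : nat -> 'rV[R]_dx) (y u : nat -> 'rV[R]_dy).
Hypothesis Lcc : convex_concave X Y L.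
Hypothesis run : PO_LMO X Y L Lyy tau beta x y u.
Hypothesis sa : standing_assumption X Y L mu Lxx Lyx Lyy.

Local Notation h t := (gap_Y Y L (x t) (y t)).

Lemma slope_bounded : (forall t, 0 <= beta t) -> (forall t, 0 <= tau t) ->
  exists2 C, 0 <= C & forall t w w', Y w -> Y w' ->
    (Lxx * enorm (x t.+1 - x t) + Lyx * enorm (w' - w)) * enorm (x t.+1 - x t)
      <= C * tau t.
Proof.
move=> beta0 tau0; have [D [G [D0 G0 HX HY HG]]] := payoff_bounds sa.
have Lxx0 := sa_Lxx_ge0 sa; have Lyx0 := ltW (sa_Lyx_gt0 sa).
exists ((Lxx * D + Lyx * D) * G) => [|t w w' Yw Yw'].
  by rewrite mulr_ge0 ?(ltW G0)// addr_ge0// mulr_ge0// ltW.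
have Xm := x_mem run; have Ym := y_mem run sa beta0.
rewrite -mulrA; apply: ler_pM; rewrite ?enorm_ge0//.
- by rewrite addr_ge0 ?mulr_ge0 ?enorm_ge0.
- by rewrite lerD// ler_wpM2l//; [exact: HX|exact: HY].
- have := projection_length (sa_X_convex sa) (Xm t) (pl_x run t) (tau0 t).
  move=> /le_trans; apply; rewrite mulrC ler_wpM2r//.
  by case: (HG _ _ (Xm t) (Ym t)).
Qed.

(** Regularization is treated as a perturbation of the recursion for the gap of
    the original payoff. With [s t = (t + 1) ^ (- 1 / 3)] the drift due to the
    move of [x] is [O(s ^ 2)] and the level of the alternative is [O(s)], which
    is the equilibrium of [h' = h - c * h ^ 2 + s ^ 2]. *)
Theorem concave_rates : Theta_pow (2 / 3) tau -> Theta_pow (1 / 3) beta ->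
  O_pow (1 / 3) (average (fun t => gap_opt X Y L (x t))) /\
  O_pow (1 / 3) (average (fun t => h t)).
Proof.
move=> /(@Theta_pow_nroot R 2 3)[c1 [c2 [c10 c20 tauE]]].
move=> /(@Theta_pow_nroot R 1 3)[b1 [b2 [b10 b20 betaE]]].
pose z t : R := nroot R 3 t; have z0 t : 0 < z t := nroot_gt0 R 3 t.
have z1 t : 1 <= z t := nroot_ge1 R 3 t.
have tau0 t : 0 < tau t.
  by apply: lt_le_trans (tauE t).1; rewrite divr_gt0// exprn_gt0.
have betap t : 0 < beta t.
  by apply: lt_le_trans (betaE t).1; rewrite divr_gt0// exprn_gt0.
have beta0 t : 0 <= beta t by rewrite ltW.
pose s t := (z t)^-1.
have s0 t : 0 < s t by rewrite invr_gt0.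
have s1 t : s t <= 1 by rewrite invf_le1.
have tau_s t : tau t <= c2 * s t ^+ 2.
  by apply: le_trans (tauE t).2 _; rewrite exprVn.
have beta_s t : beta t <= b2 * s t by exact: (betaE t).2.
have sd t : s t.+1 <= s t by rewrite lef_pV2 ?posrE//; exact: nroot_le.
have Xm := x_mem run; have Ym := y_mem run sa beta0.
have [H H0 HH] := gap_Y_bounded Lcc sa; have Lyy0 := sa_Lyy_ge0 sa.
have [c [K [c0 K0 prog]]] := fw_quadratic Lcc sa (Lyy + b2).
have [C C0 slope] := slope_bounded beta0 (fun t => ltW (tau0 t)).
have rec t : h t.+1 <= h t - c * h t ^+ 2 + C * c2 * s t ^+ 2 \/
             h t.+1 <= 2 * K * b2 * s t + C * c2 * s t ^+ 2.
  have [y' by'] := best_response_ex sa (Xm t.+1).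
  have := gap_Y_step Lcc sa (Xm t) (Xm t.+1) (Ym t.+1) by'.
  have := slope t (y t.+1) y' (Ym t.+1) by'.1.
  have := ler_wpM2l C0 (tau_s t).
  have M : 0 < Lyy + beta t <= Lyy + b2.
    rewrite ltr_wpDl//= lerD2l; apply: le_trans (beta_s t) _.
    by rewrite ler_piMr// ltW.
  have [] := prog _ _ _ _ _ (beta0 t) M (run_oracle run sa beta0 t).
  rewrite -(y_next run t) => p1 p2.
  have [/p1 hK|/ltW/p2 hK] := leP (K * beta t) (h t).
    by left; lra.
  have := ler_wpM2l (mulr_ge0 (ler0n _ 2) K0) (beta_s t).
  by right; lra.
have hb t : 0 <= h t <= H by rewrite (gap_Y_ge0 sa)// HH.
have K2 : 0 <= 2 * K * b2 by rewrite !mulr_ge0// ltW.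
have Cc2 : 0 <= C * c2 by rewrite mulr_ge0// ltW.
have sP t : [/\ 0 <= s t.+1, s t.+1 <= s t & s t <= 1].
  by split => //; exact: ltW.
have [C1 C10 HC1] := clipped_sum c0 K2 Cc2 hb sP rec.
have ssum T : \sum_(0 <= t < T.+1) s t ^+ 2 <= 3 * z T.
  have := sum_nroot3_sqr R T.
  by under eq_bigr do rewrite -exprVn.
have zz T : z T <= z T ^+ 2 by rewrite expr2 ler_peMl// ltW.
have z3 T : z T ^+ 3 = T.+1%:R by exact: nroot_exp.
pose C2 := 4 * C1 + 1.
have C20 : 0 <= C2 by rewrite /C2; lra.
have hsum T : \sum_(0 <= t < T.+1) h t <= C2 * z T ^+ 2.
  have key t : s T * h t <= h t ^+ 2 + s T ^+ 2.
    have /andP[h0 _] := hb t.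
    by have := young_pow 1 h0 (ltW (s0 T)); rewrite expr1.
  have : s T * \sum_(0 <= t < T.+1) h t
      <= \sum_(0 <= t < T.+1) h t ^+ 2 + T.+1%:R * s T ^+ 2.
    rewrite mulr_sumr; apply: le_trans (ler_sum _ (fun t _ => key t)) _.
    by rewrite big_split/= sumr_const_nat subn0 mulr_natl.
  have -> : T.+1%:R * s T ^+ 2 = z T.
    by rewrite -z3 /s; field; rewrite gt_eqF.
  move=> /(ler_wpM2l (ltW (z0 T))); rewrite mulrA /s divff ?gt_eqF// mul1r.
  move=> /le_trans; apply.
  have := HC1 T.+1; have := ler_wpM2l C10 (ssum T).
  have := ler_wpM2l C10 (z1 T) => H1 H2 H3.
  have -> : C2 * z T ^+ 2 = z T * (4 * (C1 * z T) + z T) by rewrite /C2; ring.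
  by rewrite ler_wpM2l ?(ltW (z0 T))//; lra.
split; last first.
  exists C2 => T T1; apply: (@average_rate R 1 2) => //; exact: hsum.
have zW t : 0 < z t ^+ 2 <= z t.+1 ^+ 2.
  rewrite exprn_gt0//= lerXn2r ?nnegrE ?(ltW (z0 _))//; exact: nroot_le.
have tauW t : c1 / z t ^+ 2 <= tau t <= c2 / z t ^+ 2.
  by apply/andP; exact: tauE.
pose E t := h t + C * tau t.
have E0 t : 0 <= E t.
  by rewrite addr_ge0 ?(mulr_ge0 C0 (ltW (tau0 t)))//; case/andP: (hb t).
have [|C3 C30 HC3] := gap_opt_sum Lcc run sa c10 c20 zW tauW E0.
  move=> t v Xv; have [y' by'] := best_response_ex sa (Xm t.+1).
  have := gap_opt_step Lcc run sa beta0 (ltW (tau0 t)) Xv by'.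
  have := ler_wpM2l (ltW (tau0 t)) (slope t (y t) y' (Ym t) by'.1).
  by have := sqr_ge0 (enorm (x t.+1 - x t)); rewrite /E; lra.
pose C4 := C3 * (2 + C2 + C * (c2 * 3)).
have C40 : 0 <= C4.
  have := mulr_ge0 C0 (ltW c20) => Cc; apply: mulr_ge0 => //; lra.
exists C4 => T T1; apply: (@average_rate R 1 2) => //.
apply: le_trans (HC3 T) _; rewrite -mulrA ler_wpM2l//.
have : \sum_(0 <= t < T.+1) E t <= C2 * z T ^+ 2 + C * (c2 * (3 * z T)).
  rewrite big_split/= lerD// -mulr_sumr ler_wpM2l//.
  apply: (@le_trans _ _ (\sum_(0 <= t < T.+1) c2 * s t ^+ 2)).
    by apply: ler_sum => t _.
  by rewrite -mulr_sumr ler_wpM2l// ltW.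
have := ler_wpM2l (mulr_ge0 C0 (ltW c20)) (zz T); have := z1 T; have := zz T.
rewrite -/(z T); lra.
Qed.

End ConcaveRates.

(** * Rates for strongly concave payoffs *)

Section StrongRates.
Variables (R : realType) (dx dy : nat).
Variables (X : set 'rV[R]_dx) (Y : set 'rV[R]_dy).
Variable L : 'rV[R]_dx -> 'rV[R]_dy -> R.
Variables (mu Lxx Lyx Lyy : R).
Variables (tau beta : nat -> R).
Variables (x : nat -> 'rV[R]_dx) (y u : nat -> 'rV[R]_dy).
Hypothesis Lcc : convex_concave X Y L.
Hypothesis run : PO_LMO X Y L Lyy tau beta x y u.
Hypothesis sa : standing_assumption X Y L mu Lxx Lyx Lyy.
Hypothesis mu0 : 0 < mu.

Local Notation f := (primal Y L).
Local Notation F t := (gap_opt X Y L (x t)).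
Local Notation h t := (gap_Y Y L (x t) (y t)).

(** For small [a] the terms of second order in the length of the move are
    absorbed by half of its square. For large [a], as [X] is bounded, they
    are charged to [a ^ m.+1]; in a run this concerns finitely many steps. *)
Lemma slope_absorbed (c2 : R) m : 0 < c2 -> exists2 C, 0 <= C &
  forall p p' (w w' : 'rV[R]_dy) (a : R), X p -> X p' -> Y w ->
    best_response Y L p' w' -> 0 < a <= c2 ->
    a * ((Lxx * enorm (p' - p) + Lyx * enorm (w' - w)) * enorm (p' - p))
      <= enorm (p' - p) ^+ 2 / 2 + C * a ^+ 2 * gap_Y Y L p w + C * a ^+ m.+1.
Proof.
move=> c20; have [C0 C00 HC0] := best_response_dist Lcc sa mu0.
have [D [G [D0 G0 HX HY HG]]] := payoff_bounds sa.
have Lxx0 := sa_Lxx_ge0 sa; have Lyx0 := sa_Lyx_gt0 sa.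
pose k := Lyx ^+ 2 * C0.
have k0 : 0 <= k by rewrite mulr_ge0 ?sqr_ge0 ?(ltW C00).
pose K := Lxx + k * c2.
have K0 : 0 <= K by apply: addr_ge0 => //; rewrite mulr_ge0 ?(ltW c20).
pose C1 := K * D ^+ 2 * (4 * K) ^+ m.
have C10 : 0 <= C1.
  by apply: mulr_ge0; [rewrite mulr_ge0 ?sqr_ge0|rewrite exprn_ge0 ?mulr_ge0].
exists (k + C1); first exact: addr_ge0.
move=> p p' w w' a Xp Xp' Yw bw' /andP[a0 ac].
have dD : enorm (p' - p) ^+ 2 <= D ^+ 2.
  by rewrite lerXn2r ?nnegrE ?enorm_ge0 ?(ltW D0)// HX.
have := HC0 _ _ _ _ Xp Xp' Yw bw'.
have := gap_Y_ge0 sa Xp Yw.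
move: dD; move: (gap_Y _ _ p w) (enorm (p' - p)) (enorm (w' - w)) => g d e.
move=> dD g0 eg.
have young : a * (Lyx * e * d) <= d ^+ 2 / 4 + k * a ^+ 2 * (g + d ^+ 2).
  have : 0 <= (d / 2 - a * Lyx * e) ^+ 2 by exact: sqr_ge0.
  have a2 : 0 <= a ^+ 2 * Lyx ^+ 2 by rewrite mulr_ge0// sqr_ge0.
  by have := ler_wpM2l a2 eg; rewrite /k; lra.
have quad : a * (Lxx * d * d) + k * a ^+ 2 * d ^+ 2 <= K * a * d ^+ 2.
  have : 0 <= k * a * d ^+ 2 * (c2 - a).
    apply: mulr_ge0; last by rewrite subr_ge0.
    by rewrite mulr_ge0 ?sqr_ge0// mulr_ge0 ?(ltW a0).
  by rewrite /K; lra.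
have large : K * a * d ^+ 2 <= d ^+ 2 / 4 + C1 * a ^+ m.+1.
  have [Ka|Ka] := leP (4 * K * a) 1.
    have : 0 <= C1 * a ^+ m.+1 by rewrite mulr_ge0// exprn_ge0// ltW.
    by have := ler_wpM2r (sqr_ge0 d) Ka; lra.
  have Kam : 1 <= (4 * K * a) ^+ m by rewrite exprn_ege1// ltW.
  have KD : 0 <= K * a * D ^+ 2.
    by rewrite mulr_ge0 ?sqr_ge0// mulr_ge0 ?(ltW a0).
  have -> : C1 * a ^+ m.+1 = K * a * D ^+ 2 * (4 * K * a) ^+ m.
    by rewrite /C1 (exprMn _ (4 * K)) (exprS a); ring.
  have := ler_wpM2l KD Kam; have := ler_wpM2l (mulr_ge0 K0 (ltW a0)) dD.
  by have := sqr_ge0 d; lra.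
have : 0 <= C1 * a ^+ 2 * g by rewrite mulr_ge0// mulr_ge0 ?sqr_ge0.
have : 0 <= k * a ^+ m.+1 by rewrite mulr_ge0// exprn_ge0// ltW.
lra.
Qed.

(** The exponent [n] records the progress of the dual step. In the potential
    [h + F] the terms [tau * r ^ n] and [c * r ^ n.+1] balance at [r] of order
    [tau], and [tau ^ n.+1] is summable up to a logarithm exactly for the step
    sizes considered. *)
Theorem strong_rates n (c : R) : 0 < c -> (0 < n)%N ->
  (forall y0 p w v (r : R), fw_oracle X Y L y0 0 p w v -> 0 <= r ->
     r ^+ n = gap_Y Y L p w ->
     gap_Y Y L p (fw_next L Lyy y0 0 p w v)
       <= gap_Y Y L p w - c * r ^+ n.+1) ->
  Theta_pow (1 / n.+1%:R) tau -> (forall t, beta t = 0) ->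
  softO_pow (n%:R / n.+1%:R) (average (fun t => F t)) /\
  softO_pow (n%:R / n.+1%:R) (average (fun t => h t)).
Proof.
move=> c0 n0 prog /(@Theta_pow_nroot R 1 n.+1)[c1 [c2 [c10 c20 tauE]]] betaE.
pose z t : R := nroot R n.+1 t; have z0 t : 0 < z t := nroot_gt0 R n.+1 t.
have z1 t : 1 <= z t := nroot_ge1 R n.+1 t.
have beta0 t : 0 <= beta t by rewrite betaE.
have tau0 t : 0 < tau t.
  by apply: lt_le_trans (tauE t).1; rewrite divr_gt0// exprn_gt0.
have tauc t : tau t <= c2.
  by apply: le_trans (tauE t).2 _; rewrite expr1 ler_piMr ?(ltW c20)// invf_le1.
have Xm := x_mem run; have Ym := y_mem run sa beta0.
have h0 t : 0 <= h t by apply: (gap_Y_ge0 sa).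
have F0 t : 0 <= F t by exact: (gap_opt_ge0 Lcc sa).
pose r t := h t `^ (n%:R^-1).
have r0 t : 0 <= r t by exact: powR_ge0.
have rE t : r t ^+ n = h t.
  by rewrite -powR_mulrn// -powRrM mulVf ?powRr1// pnatr_eq0 -lt0n.
have hplus t : gap_Y Y L (x t) (y t.+1) <= h t - c * r t ^+ n.+1.
  rewrite (y_next run t) betaE; apply: prog => //.
  by rewrite -(betaE t); exact: (run_oracle run sa beta0).
have [C C0 HC] := slope_absorbed n.+1 c20.
have ac t : 0 < tau t <= c2 by rewrite tau0 tauc.
have descent t : h t.+1 + F t.+1 <= h t + F t - c * r t ^+ n.+1
    + 2 * C * tau t * r t ^+ n + 2 * C * tau t ^+ n.+1.
  have [y' by'] := best_response_ex sa (Xm t.+1).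
  have s1 := HC _ _ _ _ _ (Xm t) (Xm t.+1) (Ym t) by' (ac t).
  have s2 := HC _ _ _ _ _ (Xm t) (Xm t.+1) (Ym t.+1) by' (ac t).
  have d1 := ler_wpM2l (ltW (tau0 t))
    (primal_step Lcc sa (Xm t) (Xm t.+1) (Ym t) by').
  have d2 := ler_wpM2l (ltW (tau0 t))
    (gap_Y_step Lcc sa (Xm t) (Xm t.+1) (Ym t.+1) by').
  have pd := projection_descent (sa_X_convex sa) (Xm t) (pl_x run t).
  have hp := ler_wpM2l (ltW (tau0 t)) (hplus t).
  have Ct : 0 <= C * tau t ^+ 2 by rewrite mulr_ge0// sqr_ge0.
  have cr : 0 <= c * r t ^+ n.+1 by rewrite mulr_ge0 ?exprn_ge0 ?(ltW c0).
  have hp2 : C * tau t ^+ 2 * gap_Y Y L (x t) (y t.+1) <= C * tau t ^+ 2 * h t.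
    by rewrite ler_wpM2l//; have := hplus t; lra.
  (* After multiplication by [tau], the decrease of the primal function is the
     full squared length of the move: one half absorbs the second-order terms of
     the primal step, the other those of the dual gap. *)
  rewrite -(ler_pM2l (tau0 t)) rE /gap_opt.
  move: s1 s2; rewrite (exprS (tau t) n.+1); lra.
have Phi0 t : 0 <= h t + F t by rewrite addr_ge0.
have [C1 C10 HC1] := potential_sum c0 (mulr_ge0 (ler0n _ 2) C0) r0 Phi0
  (fun t => ltW (tau0 t)) descent.
pose l T : R := 1 + ln T%:R.
have l1 T : (0 < T)%N -> 1 <= l T.
  by move=> T0; rewrite /l lerDl ln_ge0// ler1n.
pose C2 := c2 ^+ n.+1; have C20 : 0 <= C2 by rewrite exprn_ge0// ltW.
have tausum T : (0 < T)%N ->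
    \sum_(0 <= t < T.+1) tau t ^+ n.+1 <= 2 * C2 * l T.
  move=> T0; have tz t : tau t ^+ n.+1 <= C2 * (t.+1%:R)^-1.
    have : tau t ^+ n.+1 <= (c2 / z t ^+ 1) ^+ n.+1.
      rewrite lerXn2r ?nnegrE ?(ltW (tau0 t))//.
        by rewrite expr1 divr_ge0 ?(ltW c20) ?(ltW (z0 t)).
      exact: (tauE t).2.
    by rewrite expr1 expr_div_n nroot_exp.
  apply: le_trans (ler_sum _ (fun t _ => tz t)) _.
  have -> : 2 * C2 * l T = C2 * (2 * l T) by ring.
  rewrite -mulr_sumr ler_wpM2l//.
  rewrite big_nat_recr//=.
  have T1 : (T.+1%:R)^-1 <= 1 :> R by rewrite invf_le1// ler1n.
  apply: le_trans (lerD (sum_inv_le_ln R T0) T1) _.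
  by have := l1 T T0; rewrite -/(l T); lra.
pose C3 := C1 * (1 + 2 * C2) + 1.
have C30 : 0 <= C3.
  by rewrite addr_ge0// mulr_ge0// addr_ge0// mulr_ge0.
have hsum T : (0 < T)%N -> \sum_(0 <= t < T.+1) h t <= C3 * l T * z T.
  move=> T0; have lT := l1 T T0.
  under eq_bigr do rewrite -rE.
  have rsum := le_trans (HC1 T.+1)
    (ler_wpM2l C10 (lerD (lexx 1) (tausum T T0))).
  apply: le_trans (sum_pow_le r0 rsum) _.
  rewrite ler_wpM2r ?(ltW (z0 T))//.
  by have := ler_wpM2l C10 lT; rewrite /C3; lra.
have rate (g : nat -> R) (A : R) : 0 <= A ->
    (forall T, (0 < T)%N -> \sum_(0 <= t < T.+1) g t <= A * l T * z T) ->
    softO_pow (n%:R / n.+1%:R) (average g).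
  move=> A0 HA; exists A, 1%N => T T0; rewrite expr1 -addn1.
  apply: average_rate => //; first by rewrite addn1.
    by rewrite mulr_ge0//; exact: le_trans ler01 (l1 T T0).
  by rewrite expr1 addn1; exact: HA.
split; last exact: rate C30 hsum.
have zW t : 0 < z t <= z t.+1 by rewrite z0 nroot_le.
have tauW t : c1 / z t <= tau t <= c2 / z t.
  by apply/andP; exact: tauE.
pose E t := (1 + C * c2) * h t + C * tau t ^+ n.+1.
have Cc0 : 0 <= C * c2 by rewrite mulr_ge0// ltW.
have E0 t : 0 <= E t.
  apply: addr_ge0; first by rewrite mulr_ge0// addr_ge0.
  by apply: mulr_ge0 => //; rewrite exprn_ge0 ?(ltW (tau0 t)).
have [|C4 C40 HC4] := gap_opt_sum Lcc run sa c10 c20 zW tauW E0.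
  move=> t v Xv; have [y' by'] := best_response_ex sa (Xm t.+1).
  have := gap_opt_step Lcc run sa beta0 (ltW (tau0 t)) Xv by'.
  have := HC _ _ _ _ _ (Xm t) (Xm t.+1) (Ym t) by' (ac t).
  have : 0 <= C * tau t * (c2 - tau t) * h t.
    by rewrite !mulr_ge0// ?(ltW (tau0 t))// subr_ge0.
  by rewrite /E (exprS (tau t) n.+1); lra.
pose C5 := C4 * (2 + (1 + C * c2) * C3 + C * (2 * C2)).
have q1 : 0 <= (1 + C * c2) * C3 by rewrite mulr_ge0// addr_ge0.
have q2 : 0 <= C * (2 * C2) by rewrite !mulr_ge0.
apply: (rate _ C5) => [|T T0]; first by rewrite mulr_ge0//; lra.
apply: le_trans (HC4 T) _; rewrite -!mulrA ler_wpM2l//.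
have : \sum_(0 <= t < T.+1) E t
    <= (1 + C * c2) * (C3 * l T * z T) + C * (2 * C2 * l T).
  rewrite big_split/= -!mulr_sumr lerD// ler_wpM2l// ?addr_ge0//.
    exact: hsum.
  exact: tausum.
have lT := l1 T T0; have zT := z1 T.
have lz : 1 <= l T * z T by rewrite -[leLHS]mulr1 ler_pM.
have zl : z T <= l T * z T by rewrite ler_peMl// ltW.
have ll : l T <= l T * z T by rewrite ler_peMr// (le_trans ler01 lT).
have := ler_wpM2l q2 ll.
lra.
Qed.

End StrongRates.

Theorem theorem4p2 (R : realType) (dx dy : nat)
    (X : set 'rV[R]_dx) (Y : set 'rV[R]_dy)
    (L : 'rV[R]_dx -> 'rV[R]_dy -> R)
    (mu Lxx Lyx Lyy : R)
    (tau beta : nat -> R) (sigma : R)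
    (x : nat -> 'rV[R]_dx) (y u : nat -> 'rV[R]_dy)
    (Lcc : convex_concave X Y L)
    (xy_run : PO_LMO X Y L Lyy tau beta x y u)
    (sigma_gt0 : 0 < sigma) (sigmaE : sigma = tau 0%N) :
  (* (i) *)
  (standing_assumption X Y L mu Lxx Lyx Lyy ->
   Theta_pow (2 / 3) tau -> Theta_pow (1 / 3) beta ->
   O_pow (1 / 3) (average (fun t => gap_opt X Y L (x t))) /\
   O_pow (1 / 3) (average (fun t => gap_Y Y L (x t) (y t)))) /\
  (* (ii) *)
  (standing_assumption X Y L mu Lxx Lyx Lyy -> 0 < mu ->
   Theta_pow (1 / 2) tau -> (forall t, beta t = 0) ->
   softO_pow (1 / 2) (average (fun t => gap_opt X Y L (x t))) /\
   softO_pow (1 / 2) (average (fun t => gap_Y Y L (x t) (y t)))) /\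
  (* (iii) *)
  (forall alpha : R,
   standing_assumption X Y L mu Lxx Lyx Lyy -> 0 < mu ->
   0 < alpha -> strongly_convex_set alpha Y ->
   Theta_pow (1 / 3) tau -> (forall t, beta t = 0) ->
   softO_pow (2 / 3) (average (fun t => gap_opt X Y L (x t))) /\
   softO_pow (2 / 3) (average (fun t => gap_Y Y L (x t) (y t)))).
Proof.
split; first by move=> sa; exact: (concave_rates Lcc xy_run sa).
split=> [sa mu0|alpha sa mu0 alpha0 scY].
  have [c c0 prog] := fw_quadratic_strong Lcc sa mu0.
  apply: (strong_rates Lcc xy_run sa mu0 c0 (n := 1)) => // y0 p w v r o _.
  by rewrite expr1 => ->; exact: prog o.
have [c c0 prog] := fw_cubic Lcc sa mu0 alpha0 scY.
apply: (strong_rates Lcc xy_run sa mu0 c0 (n := 2)) => //.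
Qed.
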